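(* Let $\{P(t)\}_{t=0}^\infty$ be an i.i.d. sequence of random doubly stochastic matrices, and define $\lambda_2(G)=\lambda_2\big(\mathbb{E}[P(t)^\top P(t)]\big)$. Let $\{x_i(t)\}$ be generated by the distributed dual averaging updates with time-varying matrices $P(t)$ (see context) and a non-increasing sequence of positive step sizes $\{\alpha(t)\}_{t=0}^\infty$. For any $x^*\in\mathcal{X}$ and $i\in V$, with probability at least $1-1/T$, $$f(\hat x_i(T))-f(x^* )\le\frac{1}{T\alpha(T)}\psi(x^* )+\frac{L^2}{2T}\sum_{t=1}^T\alpha(t-1)+\frac{3L^2}{T}\left(\frac{6\log(T^2n)}{1-\lambda_2(G)}+\frac{1}{T\sqrt n}+2\right)\sum_{t=1}^T\alpha(t).$$
   Context: Problem: $G=(V,E)$ is an undirected graph with $V=\{1,\dots,n\}$; each $f_i:\mathbb{R}^d\to\mathbb{R}$ ($i\in V$) is convex; $\mathcal{X}\subseteq\mathbb{R}^d$ is closed and convex with $0\in\mathcal{X}$; $f(x)=\frac1n\sum_{i=1}^n f_i(x)$ is to be minimized over $\mathcal{X}$. Norms and Lipschitz assumption: $\|\cdot\|$ is a norm on $\mathbb{R}^d$ with dual norm $\|v\|_*=\sup_{\|u\|=1}\langle v,u\rangle$. Each $f_i$ is $L$-Lipschitz on $\mathcal{X}$: $|f_i(x)-f_i(y)|\le L\|x-y\|$ for $x,y\in\mathcal{X}$, and all subgradients $g\in\partial f_i(x)$, $x\in\mathcal{X}$, satisfy $\|g\|_*\le L$. Proximal function: $\psi:\mathbb{R}^d\to\mathbb{R}$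 is differentiable and 1-strongly convex w.r.t. $\|\cdot\|$ on $\mathcal{X}$, i.e. $\psi(y)\ge\psi(x)+\langle\nabla\psi(x),y-x\rangle+\frac12\|x-y\|^2$ for all $x,y\in\mathcal{X}$; moreover $\psi\ge0$ on $\mathcal{X}$ and $\psi(0)=0$. For $z\in\mathbb{R}^d$, $\alpha>0$ set $\Pi(z,\alpha)=\operatorname{argmin}_{x\in\mathcal{X}}\{\langle z,x\rangle+\frac1\alpha\psi(x)\}$. Communication matrices: each $P(t)\in\mathbb{R}^{n\times n}$ is doubly stochastic (nonnegative entries, row and column sums equal to 1) and respects $G$: $P_{ij}(t)>0$ for $i\neq j$ only if $(i,j)\in E$. For a symmetric matrix $B$, $\lambda_1(B)\ge\lambda_2(B)\ge\cdots$ are its eigenvalues; it is understood that $\lambda_2(G)<1$. Distributed dual averaging with stochastic communication: start with $z_i(1)=0$ and $x_i(1)=\Pi(0,\alpha(0))$ for all $i$. For $t\ge1$ each node $i$ picks $g_i(t)\in\partial f_i(x_i(t))$ and sets $z_i(t+1)=\sum_{j=1}^n P_{ij}(t)z_j(t)+g_i(t)$ and $x_i(t+1)=\Pi(z_i(t+1),\alpha(t))$. The running local average is $\hat x_i(T)=\frac1T\sum_{t=1}^T x_i(t)$, $T\ge1$. *)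

(* Defs.v *)
(* MathComp-Analysis; vectors of R^d are row vectors 'rV[R]_d. *)
From HB Require Import structures.
From mathcomp Require Import all_boot all_order all_algebra.
From mathcomp Require Import all_classical all_reals all_analysis.
From mathcomp Require complex.

Set Implicit Arguments.
Unset Strict Implicit.
Unset Printing Implicit Defensive.

Import Order.TTheory GRing.Theory Num.Theory.
Import numFieldNormedType.Exports.

Local Open Scope classical_set_scope.
Local Open Scope ring_scope.

Section Geometry.
Context {R : realType} {d : nat}.
Implicit Types (N : 'rV[R]_d -> R) (X : set 'rV[R]_d) (h psi : 'rV[R]_d -> R).

Definition dot (u v : 'rV[R]_d) : R := \sum_(k < d) u 0 k * v 0 k.

(* An arbitrary norm on R^d, unrelated to the library's sup norm `|_| (which
   only provides the topology, the same for all norms). *)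
Definition is_norm N : Prop :=
  [/\ forall u v, N (u + v) <= N u + N v,
      forall (a : R) u, N (a *: u) = `|a| * N u
    & forall u, N u = 0 -> u = 0].

Definition dual_norm N (v : 'rV[R]_d) : R :=
  sup [set dot v u | u in [set u | N u = 1]].

Definition subdifferential h (x : 'rV[R]_d) : set 'rV[R]_d :=
  [set g | forall y, h x + dot g (y - x) <= h y].

Definition lipschitz_wrt N X (L : R) h : Prop :=
  forall x y, X x -> X y -> `|h x - h y| <= L * N (x - y).

Definition grad h (x : 'rV[R]_d) : 'rV[R]_d :=
  \row_(k < d) 'D_(delta_mx 0 k) h x.

Definition strongly_convex1 N X psi : Prop :=
  forall x y, X x -> X y ->
    psi x + dot (grad psi x) (y - x) + 2^-1 * N (x - y) ^+ 2 <= psi y.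

Definition proximal_function N X psi : Prop :=
  [/\ forall x, differentiable psi x,
      strongly_convex1 N X psi,
      forall x, X x -> 0 <= psi x
    & psi 0 = 0].

Definition argmin X h : set 'rV[R]_d :=
  [set x | X x /\ forall y, X y -> h x <= h y].

(* The projection as the set of minimizers; it is a singleton for a proximal
   function psi and X closed, convex and nonempty. *)
Definition prox X psi (z : 'rV[R]_d) (a : R) : set 'rV[R]_d :=
  argmin X (fun x => dot z x + a^-1 * psi x).

End Geometry.

Section Spectrum.
Import complex.

Lemma char_poly_conj (F : fieldType) n (P D : 'M[F]_n) : P \in unitmx ->
  char_poly (invmx P *m D *m P) = char_poly D.
Proof.
move=> uP; rewrite /char_poly /char_poly_mx.
have E : map_mx polyC (invmx P) *m map_mx polyC P = 1%:M.
  by rewrite -map_mxM mulVmx// map_mx1.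
have -> : 'X%:M - map_mx polyC (invmx P *m D *m P) =
   map_mx polyC (invmx P) *m ('X%:M - map_mx polyC D) *m map_mx polyC P.
  rewrite !map_mxM mulmxBr mulmxBl; congr (_ - _).
  by rewrite scalar_mxC -mulmxA E mulmx1.
by rewrite !det_mulmx mulrAC -det_mulmx E det1 mul1r.
Qed.

(* The eigenvalues in nonincreasing order, repeated with multiplicity. The
   sequence is unique when it exists, which is the case for every symmetric
   matrix by eigenvaluesP; the default value [::] is only used for matrices
   whose characteristic polynomial does not split over R. *)
Definition eigenvalues (R : realType) n (B : 'M[R]_n) : seq R :=
  xget [::] [set s | char_poly B = \prod_(a <- s) ('X - a%:P) /\
                     sorted (fun a b => b <= a) s].

Lemma eigenvaluesP (R : realType) n (B : 'M[R]_n) : B^T = B ->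
  char_poly B = \prod_(a <- eigenvalues B) ('X - a%:P) /\
  sorted (fun a b => b <= a) (eigenvalues B).
Proof.
move=> symB.
suff [s sB] : exists s, [set s | char_poly B = \prod_(a <- s) ('X - a%:P) /\
                     sorted (fun a b : R => b <= a) s] s.
  have : [set s | char_poly B = \prod_(a <- s) ('X - a%:P) /\
                     sorted (fun a b : R => b <= a) s] (eigenvalues B).
    by rewrite /eigenvalues; case: xgetP => // /(_ s).
  by [].
pose A := map_mx (real_complex R) B.
have Ah : A \is hermsymmx.
  apply: realsym_hermsym.
    apply/is_hermitianmxP; rewrite expr0 scale1r.
    by apply/matrixP => i j; rewrite !mxE -{1}symB mxE.
  by apply/mxOverP => i j; rewrite mxE; apply/complex_realP; exists (B i j).
have /orthomx_spectralP EA := hermitian_normalmx Ah.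
have /mxOverP Dr := hermitian_spectral_diag_real Ah.
pose s := [seq complex.Re (spectral_diag A 0 i) | i <- enum 'I_n].
exists (sort (fun a b => b <= a) s); split; last first.
  by apply: sort_sorted => a b; exact: le_total.
rewrite (perm_big s) ?perm_sort//=.
apply: (map_poly_inj (real_complex R)).
rewrite map_char_poly -/A [in LHS]EA char_poly_conj ?spectral_unit//.
rewrite char_poly_trig ?diag_mx_is_trig// rmorph_prod/= big_map big_enum/=.
apply: eq_bigr => i _; rewrite mxE eqxx mulr1n map_polyXsubC.
by rewrite /= RRe_real.
Qed.

End Spectrum.

Section Network.
Context {R : realType} {n : nat}.

Definition doubly_stochastic (M : 'M[R]_n) : Prop :=
  [/\ forall i j, 0 <= M i j,
      forall i, \sum_(j < n) M i j = 1
    & forall j, \sum_(i < n) M i j = 1].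

Definition respects_graph (e : rel 'I_n) (M : 'M[R]_n) : Prop :=
  forall i j, i != j -> 0 < M i j -> e i j.

(* Numbered from 1. If n = 1 there is no second eigenvalue and
   lambda 2 B = 0. *)
Definition lambda (k : nat) (B : 'M[R]_n) : R := nth 0 (eigenvalues B) k.-1.

End Network.

Section RandomMatrices.
Context {R : realType} {n : nat} {disp : measure_display}
  {Omega : measurableType disp} (Pr : probability Omega R).

(* The Borel sigma-algebra of the space of n x n matrices, generated by the
   coordinate functions. *)
Definition measurable_mx : set (set 'M[R]_n) :=
  <<s [set A : set 'M[R]_n | exists (i j : 'I_n) (B : set R),
         measurable B /\ A = [set M : 'M[R]_n | B (M i j)]] >>.

Definition random_mx (M : Omega -> 'M[R]_n) : Prop :=
  forall A, measurable_mx A -> measurable (M @^-1` A).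

Definition identically_distributed (P : nat -> Omega -> 'M[R]_n) : Prop :=
  forall s t A, measurable_mx A -> Pr (P s @^-1` A) = Pr (P t @^-1` A).

Definition mutually_independent (P : nat -> Omega -> 'M[R]_n) : Prop :=
  forall (J : seq nat) (A : nat -> set 'M[R]_n),
    uniq J -> (forall t, measurable_mx (A t)) ->
    Pr (\bigcap_(t in [set` J]) (P t @^-1` A t)) =
    (\prod_(t <- J) Pr (P t @^-1` A t))%E.

Definition iid_mx (P : nat -> Omega -> 'M[R]_n) : Prop :=
  [/\ forall t, random_mx (P t), identically_distributed P
    & mutually_independent P].

Definition expectation_mx (M : Omega -> 'M[R]_n) : 'M[R]_n :=
  \matrix_(i < n, j < n) fine 'E_Pr[fun w => M w i j].

(* For an identically distributed sequence, E[P(t)^T P(t)] does not depend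
   on t. *)
Definition lambda2G (P : nat -> Omega -> 'M[R]_n) : R :=
  lambda 2 (expectation_mx (fun w => (P 0 w)^T *m P 0 w)).

(* Pr is only meaningful on measurable sets; for a measurable event this is
   p <= Pr E, see with_probability_geP. *)
Definition with_probability_ge (p : R) (E : set Omega) : Prop :=
  exists A, [/\ measurable A, A `<=` E & (p%:E <= Pr A)%E].

Lemma with_probability_geP (p : R) (E : set Omega) : measurable E ->
  with_probability_ge p E <-> (p%:E <= Pr E)%E.
Proof.
move=> mE; split=> [[A [mA AE pA]]|pE]; last first.
  by exists E; split => //; exact: subset_refl.
by apply: (le_trans pA); apply: le_measure; rewrite ?inE.
Qed.

End RandomMatrices.

Section DualAveraging.
Context {R : realType} {d n : nat}.
Implicit Types (X : set 'rV[R]_d) (psi : 'rV[R]_d -> R)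
  (f : 'I_n -> 'rV[R]_d -> R) (g z x : nat -> 'I_n -> 'rV[R]_d).

Definition objective f (y : 'rV[R]_d) : R :=
  n%:R^-1 * \sum_(i < n) f i y.

(* One trajectory, for a given sequence of communication matrices. Time starts
   at t = 1 for g, z and x: their values at t = 0 are irrelevant. *)
Definition dual_averaging X psi f (alpha : nat -> R) (P : nat -> 'M[R]_n)
    g z x : Prop :=
  [/\ forall i, z 1 i = 0 /\ prox X psi 0 (alpha 0) (x 1 i),
      forall t i, (1 <= t)%N -> subdifferential (f i) (x t i) (g t i),
      forall t i, (1 <= t)%N ->
        z t.+1 i = \sum_(j < n) P t i j *: z t j + g t i
    & forall t i, (1 <= t)%N ->
        prox X psi (z t.+1 i) (alpha t) (x t.+1 i)].

Definition local_average x (T : nat) (i : 'I_n) : 'rV[R]_d :=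
  T%:R^-1 *: \sum_(1 <= t < T.+1) x t i.

End DualAveraging.

(* Main.v *)
(* The regret of dual averaging with the averaged dual state zbar(t) is the
   classical one; replacing Pi(zbar(t)) by the local iterates costs at most
   3 L alpha(t - 1) max_j |z_j(t) - zbar(t)|_*, since Pi is alpha-Lipschitz from
   the dual norm. The difference z_i(t) - zbar(t) is a combination of past
   subgradients weighted by the entries of the products P(t - 1) ... P(s + 1)
   minus 1/n. Products of at least k0 = 3 log(T^2 n) / (1 - lambda2) matrices are
   close to the uniform matrix with high probability: by independence the expected
   squared Frobenius distance shrinks by the factor lambda2 with every new matrix,
   and it never increases along a trajectory, so that Markov's inequality is
   needed for products of exactly k0 matrices only. Shorter products contribute
   at most 2 each. *)
Require Import Defs.
From HB Require Import structures.
From mathcomp Require Import all_boot all_order all_algebra.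
From mathcomp Require Import all_classical all_reals all_analysis.
From mathcomp Require Import measurable_realfun.
From mathcomp Require Import ring lra.
From mathcomp Require complex.

Set Implicit Arguments.
Unset Strict Implicit.
Unset Printing Implicit Defensive.

Import Order.TTheory GRing.Theory Num.Theory.
Import numFieldNormedType.Exports.

Local Open Scope classical_set_scope.
Local Open Scope ring_scope.

(** The subgradients, and with them the trajectories, are arbitrary functions of the sample point:
    nothing makes them measurable. All probability is therefore confined to one measurable event
    about products of the matrices, and on that event the bound is proved for each trajectory
    separately. The consensus error of [Q *m M] does not by itself split into a new and an old
    factor. Its uncentred version, larger by exactly 1, does: it is the sum over a, b of
    [(Q^T *m Q) a b * (M *m M^T) a b]. Independence then replaces the first factor by its mean W,
    and the second eigenvalue of W acts on the columns of M minus the uniform matrix, which are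
    orthogonal to the all-ones vector. The factor 3 in k0 makes lambda2^k0 at most (T^2 n)^-3. With
    initial error at most n and threshold (T^4 n^2)^-1, Markov's inequality over T products fails
    with probability at most T * n * (T^2 n)^-3 * T^4 n^2 = 1/T. *)

(** * The second eigenvalue as a bound on the quadratic form orthogonal to the all-ones vector *)

Section SecondEigenvalue.
Import complex.
Local Open Scope sesquilinear_scope.

Lemma le_lambda2 (R : realType) n (W : 'M[R]_n) (s : seq R) (b : R) :
  eigenvalues W = 1 :: s -> sorted (fun a b => b <= a) (1 :: s) ->
  b \in s -> b <= lambda 2 W.
Proof.
rewrite /lambda /= => -> /=.
case: s => [|a s] //= /andP[_ sa].
rewrite inE => /predU1P[->//|].
have tr : transitive (fun a b : R => b <= a) by move=> x y z xy /le_trans; apply.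
by move/(allP (order_path_min tr sa)).
Qed.

(** The sequence is sorted, so a 1 in its tail would force [lambda 2 W] to be at least 1. Hence the
    eigenvalue 1 sits at the head, and it is simple. *)
Lemma eigenvalues_one (R : realType) n (W : 'M[R]_n) :
  W^T = W -> root (char_poly W) 1 -> lambda 2 W < 1 ->
  exists2 s, eigenvalues W = 1 :: s & 1 \notin s.
Proof.
move=> symW r1 W1; have [cW sW] := eigenvaluesP symW.
have : 1 \in eigenvalues W by move: r1; rewrite cW root_prod_XsubC.
move: W1 sW; rewrite /lambda /=; case: (eigenvalues W) => [//|a s] /= W1 sW.
have s1 : 1 \notin s.
  apply/negP => s1; move: W1; rewrite ltNge => /negP; apply.
  case: s sW s1 => [//|b s] /= /andP[_ sb]; rewrite inE => /predU1P[<-//|].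
  have tr : transitive (fun a b : R => b <= a).
    by move=> x y z xy /le_trans; apply.
  by move/(allP (order_path_min tr sb)).
by rewrite inE (negbTE s1) orbF => /eqP <-; exists s.
Qed.

(* Over R[i], W has an orthonormal eigenbasis. As 1 is a simple eigenvalue, the
   all-ones vector is a multiple of one basis vector, and all other eigenvalues
   are at most lambda 2 W. *)
Lemma quadratic_form_le_lambda2 (R : realType) n (W : 'M[R]_n) (u : 'rV[R]_n) :
  W^T = W -> const_mx 1 *m W = const_mx 1 :> 'rV_n -> lambda 2 W < 1 ->
  u *m (const_mx 1 : 'cV_n) = 0 ->
  (u *m W *m u^T) 0 0 <= lambda 2 W * (u *m u^T) 0 0.
Proof.
case: n W u => [|n] W u symW W1 lam1 u1.
  by rewrite /lambda !mxE !big_ord0 mulr0.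
have r1 : root (char_poly W) 1.
  rewrite -eigenvalue_root_char; apply/eigenvalueP; exists (const_mx 1).
    by rewrite W1 scale1r.
  by apply/eqP => /rowP/(_ ord0); rewrite !mxE => /eqP; rewrite oner_eq0.
have [s Es s1] := eigenvalues_one symW r1 lam1.
have [cW sW] := eigenvaluesP symW; rewrite Es in cW sW.
pose toC := real_complex R.
pose A := map_mx toC W.
have Ah : A \is hermsymmx.
  apply: realsym_hermsym.
    apply/is_hermitianmxP; rewrite expr0 scale1r.
    by apply/matrixP => i j; rewrite !mxE -{1}symW mxE.
  by apply/mxOverP => i j; rewrite mxE; apply/complex_realP; exists (W i j).
have /orthomx_spectralP EA := hermitian_normalmx Ah.
have uS := spectral_unitarymx A.
move: (spectral_diag A) (spectralmx A) EA uS => D S EA uS.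
have SS : S *m S^t* = 1%:M by apply/unitarymxP.
have cA : char_poly A = \prod_k ('X - (D 0 k)%:P).
  rewrite EA char_poly_conj ?unitarymx_unit// char_poly_trig ?diag_mx_is_trig//.
  by apply: eq_bigr => i _; rewrite mxE eqxx mulr1n.
have cA' : char_poly A = ('X - 1%:P) * \prod_(a <- s) ('X - (toC a)%:P).
  rewrite -map_char_poly cW big_cons rmorphM/= map_polyXsubC/=.
  by rewrite rmorph_prod; congr (_ * _); apply: eq_bigr => a _; rewrite /= map_polyXsubC.
(* Simplicity of 1, read off the two factorizations of the characteristic polynomial: after one
   factor ['X - 1] is cancelled, a second index would leave 1 as a root of the product over [s]. *)
have D1 k k' : D 0 k = 1 -> D 0 k' = 1 -> k = k'.
  move=> Dk Dk'; apply/eqP/negPn/negP => kk'.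
  move: cA'; rewrite cA (bigD1 k)//= Dk => /mulfI.
  rewrite polyXsubC_eq0 => /(_ isT) E.
  have : root (\prod_(a <- s) ('X - (toC a)%:P)) 1.
    rewrite -E (bigD1 k')/=; last by rewrite eq_sym.
    by rewrite Dk' rootM root_XsubC eqxx.
  rewrite -(big_map toC xpredT (fun a => 'X - a%:P)) root_prod_XsubC.
  case/mapP => a sa /eqP; rewrite -(rmorph1 toC) (inj_eq (@complexI R)).
  by move=> /eqP a1; rewrite a1 sa in s1.
have Dle k : D 0 k != 1 -> exists2 a, D 0 k = toC a & a <= lambda 2 W.
  move=> Dk; have : root (char_poly A) (D 0 k).
    by rewrite cA (bigD1 k)//= rootM root_XsubC eqxx.
  rewrite cA' rootM root_XsubC (negbTE Dk)/=.
  rewrite -(big_map toC xpredT (fun a => 'X - a%:P)) root_prod_XsubC.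
  by case/mapP => a sa ->; exists a => //; exact: le_lambda2 Es sW sa.
(* For a real vector, transpose and adjoint agree; this turns the real quadratic forms below into
   sums of squared moduli of coordinates in the eigenbasis. *)
have Smap (v : 'rV[R]_n.+1) :
    S *m (map_mx toC v)^T = (map_mx toC v *m S^t*)^t*.
  rewrite trmx_mul map_mxM/= trmxCK; congr (_ *m _).
  apply/matrixP => i j; rewrite !mxE; apply/esym/CrealP/complex_realP.
  by eexists.
have S'S : S^t* *m S = 1%:M by apply: mulmx1C.
have EA' : A = S^t* *m diag_mx D *m S by rewrite {1}EA invmx_unitary.
have mapT m p (M : 'M[R]_(m, p)) : map_mx toC M^T = (map_mx toC M)^T.
  by rewrite map_trmx.
pose y := map_mx toC u *m S^t*.
pose c := map_mx toC (const_mx 1 : 'rV_n.+1) *m S^t*.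
have yW : toC ((u *m W *m u^T) 0 0) = \sum_k D 0 k * `|y 0 k| ^+ 2.
  transitivity ((map_mx toC (u *m W *m u^T)) 0 0); first by rewrite [RHS]mxE.
  rewrite !map_mxM -/A EA' mapT -!mulmxA Smap mulmxA -/y mulmxA mxE.
  apply: eq_bigr => k _; rewrite normCK mul_mx_diag !mxE.
 by rewrite mulrAC mulrC.
have yy : toC ((u *m u^T) 0 0) = \sum_k `|y 0 k| ^+ 2.
  transitivity ((map_mx toC (u *m u^T)) 0 0); first by rewrite [RHS]mxE.
  rewrite map_mxM mapT -[X in X *m _]mulmx1 -S'S -!mulmxA Smap mulmxA mxE.
  by apply: eq_bigr => k _; rewrite normCK !mxE.
(* [c] holds the coordinates of the all-ones vector. Being fixed by W, it is supported where [D] is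
   1, that is, on the single index [k0]. *)
have cD : c *m diag_mx D = c.
  have : map_mx toC (const_mx 1 *m W : 'rV_n.+1) = map_mx toC (const_mx 1).
    by rewrite W1.
  rewrite map_mxM -/A EA' => /(congr1 (mulmx^~ (S^t*))).
  by rewrite -!mulmxA SS mulmx1 mulmxA.
have yc : \sum_k y 0 k * (c 0 k)^* = 0.
  transitivity ((map_mx toC (u *m (const_mx 1 : 'cV_n.+1))) 0 0).
    rewrite map_mxM.
    rewrite -(trmx_const 1 n.+1) mapT -[X in X *m _]mulmx1 -S'S -!mulmxA.
    rewrite Smap mulmxA mxE; apply: eq_bigr => k _.
    by rewrite !mxE.
  by rewrite u1 [LHS]mxE [X in toC X]mxE; exact: (rmorph0 (real_complex R)).
have c0 : exists k, c 0 k != 0.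
  apply/existsP; apply: contraPT isT; rewrite negb_exists => /forallP c0.
  have c0' : c = 0 by apply/rowP => k; rewrite [RHS]mxE; apply/eqP/negPn/c0.
  move: c0' => /(congr1 (mulmx^~ S)); rewrite mul0mx /c -mulmxA S'S mulmx1.
  move=> /rowP/(_ ord0); rewrite [LHS]mxE [X in toC X]mxE [RHS]mxE => /eqP.
  by rewrite (inj_eq (@complexI R) 1 0) oner_eq0.
have [k0 ck0] := c0.
have cDk k : c 0 k != 0 -> D 0 k = 1.
  move=> ck; move/rowP: cD => /(_ k); rewrite mul_mx_diag mxE.
  by rewrite -[RHS]mulr1 => /(mulfI ck).
(* In coordinates, orthogonality of [u] to the all-ones vector reduces to the one term at [k0], so
   [u] has no component on the eigenvalue 1. *)
have yk0 k : D 0 k = 1 -> y 0 k = 0.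
  move=> Dk; have -> : k = k0 by apply: D1 => //; exact: cDk.
  move: yc; rewrite (bigD1 k0)//= big1 ?addr0 => [/eqP|k' k'k0].
    by rewrite mulf_eq0 conjC_eq0 (negbTE ck0) orbF => /eqP.
  have [->|/cDk Dk'] := eqVneq (c 0 k') 0; first by rewrite rmorph0 mulr0.
  by move: k'k0; rewrite (D1 k' k0 Dk' (cDk _ ck0)) eqxx.
rewrite -lecR.
have -> : (lambda 2 W * (u *m u^T) 0 0)%:C%C = toC (lambda 2 W) * toC ((u *m u^T) 0 0).
  exact: (rmorphM (real_complex R)).
rewrite -[X in X <= _]/(toC _) yW yy mulr_sumr; apply: ler_sum => k _.
have [Dk|/Dle[a -> al]] := eqVneq (D 0 k) 1.
  by rewrite yk0// normr0 expr0n/= !mulr0.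
by rewrite ler_wpM2r ?exprn_ge0//= lecR.
Qed.

End SecondEigenvalue.

(** * From independent events to products of expectations *)

Section Independence.
Context {R : realType} {disp : measure_display} {Omega : measurableType disp}
  (Pr : probability Omega R).
Local Open Scope ereal_scope.

(** The two finite measures [Pr (A]&[B)] and [Pr A * Pr B], as functions of A, agree on the
    pi-system [G], hence on the sigma-algebra that it generates. *)
Lemma g_sigma_algebra_independent (G : set (set Omega)) (B : set Omega) :
  G `<=` measurable -> setI_closed G -> G [set: Omega] -> measurable B ->
  (forall A, G A -> Pr (A `&` B) = Pr A * Pr B) ->
  forall A, <<s G >> A -> Pr (A `&` B) = Pr A * Pr B.
Proof.
move=> Gm GI GT mB GB A sA.
have finB : Pr B \is a fin_num by exact: fin_num_measure.
have B0 : (0 <= fine (Pr B))%R by exact: fine_ge0.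
pose m1 : {measure set Omega -> \bar R} := mrestr Pr mB.
pose m2 : {measure set Omega -> \bar R} := mscale (NngNum B0) Pr.
have m2E C : m2 C = Pr C * Pr B by rewrite /m2 /= /mscale /= fineK// muleC.
rewrite -m2E; change (m1 A = m2 A).
apply: (g_sigma_algebra_measure_unique G Gm (fun=> setT)) => //.
- by rewrite bigcup_const//; exists 0%N.
- by move=> C GC; rewrite m2E /m1 /= /mrestr GB.
- by move=> _; rewrite /m1 /= /mrestr; rewrite setTI ltey_eq finB.
Qed.

(** The joint law of [X] and [Y] is the product of their laws, and Tonelli's theorem separates the
    integrals. The value spaces are arbitrary because one variable will be a matrix and the other
    the whole past. *)
Lemma ge0_expectation_prod d1 d2 (T1 : measurableType d1) (T2 : measurableType d2)
    (X : {mfun Omega >-> T1}) (Y : {mfun Omega >-> T2}) (u : T1 -> R) (v : T2 -> R) :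
  measurable_fun setT u -> measurable_fun setT v ->
  (forall x, 0 <= u x)%R -> (forall y, 0 <= v y)%R ->
  (forall A B, measurable A -> measurable B ->
    Pr (X @^-1` A `&` Y @^-1` B) = Pr (X @^-1` A) * Pr (Y @^-1` B)) ->
  'E_Pr[fun w => u (X w) * v (Y w)]%R = 'E_Pr[u \o X] * 'E_Pr[v \o Y].
Proof.
move=> mu mv u0 v0 XY.
have mXY : measurable_fun setT (fun w => (X w, Y w)) by exact: measurable_fun_pair.
pose Z : {mfun Omega >-> (T1 * T2)%type} := mfun_Sub (mem_set mXY).
pose f (z : T1 * T2) : \bar R := (u z.1 * v z.2)%R%:E.
have f0 z : 0 <= f z by rewrite lee_fin mulr_ge0.
have mf : measurable_fun setT f.
  by apply/measurable_EFinP; apply: measurable_funM; apply: measurableT_comp.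
transitivity (\int[distribution Pr Z]_z f z).
  by rewrite ge0_integral_distribution// unlock.
transitivity (\int[distribution Pr X \x distribution Pr Y]_z f z).
  apply: eq_measure_integral => A mA _; apply/esym.
  by apply: product_measure_unique => // B C mB mC; exact: XY.
rewrite fubini_tonelli1//.
have -> : 'E_Pr[v \o Y] = \int[distribution Pr Y]_y (v y)%:E.
  rewrite unlock ge0_integral_distribution//; first exact/measurable_EFinP.
have -> : 'E_Pr[u \o X] = \int[distribution Pr X]_x (u x)%:E.
  rewrite unlock ge0_integral_distribution//; first exact/measurable_EFinP.
rewrite -ge0_integralZr//; last 3 first.
- exact/measurable_EFinP.
- by move=> x _; rewrite lee_fin.
- by apply: integral_ge0 => y _; rewrite lee_fin.
apply: eq_integral => x _; rewrite /fubini_F /f /=.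
under eq_integral do rewrite EFinM.
rewrite ge0_integralZl_EFin//; first by move=> y _; rewrite lee_fin.
exact/measurable_EFinP.
Qed.

End Independence.

(** * The sigma-algebra of the matrices before a given time, and its independence from the next
    matrix *)

Section Past.
Context {R : realType} {n : nat} {disp : measure_display}
  {Omega : measurableType disp} (Pr : probability Omega R)
  (P : nat -> Omega -> 'M[R]_n).
Local Open Scope ereal_scope.

Definition coordinate_cylinders : set (set 'M[R]_n) :=
  [set A : set 'M[R]_n | exists (i j : 'I_n) (B : set R),
     measurable B /\ A = [set M : 'M[R]_n | B (M i j)]].

(** Joint cylinders over [P 0], ..., [P (m - 1)] rather than events about a single matrix: they form
    a pi-system generating the same sigma-algebra. *)
Definition past (m : nat) : set (set Omega) :=
  [set A | exists2 B : nat -> set 'M[R]_n, forall t, measurable_mx (B t) &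
    A = \bigcap_(t in [set` iota 0 m]) P t @^-1` B t].

Lemma measurable_mxT : measurable_mx [set: 'M[R]_n].
Proof. exact: (@measurableT _ (g_sigma_algebraType coordinate_cylinders)). Qed.

Lemma past_preimage m t (B : set 'M[R]_n) : (t < m)%N -> measurable_mx B ->
  past m (P t @^-1` B).
Proof.
move=> tm mB; exists (fun s => if s == t then B else setT).
  by move=> s; case: ifP => // _; exact: measurable_mxT.
apply/seteqP; split=> [w Bw s _ /=|w /(_ t)/=]; last first.
  by rewrite eqxx mem_iota/=; exact.
by case: eqP => [->|].
Qed.

Lemma past_setT m : past m setT.
Proof.
exists (fun=> setT); first by move=> _; exact: measurable_mxT.
by apply/seteqP; split.
Qed.

Lemma past_setI_closed m : setI_closed (past m).
Proof.
move=> _ _ [B mB ->] [C mC ->]; exists (fun t => B t `&` C t).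
  move=> t; apply: (@measurableI _ (g_sigma_algebraType coordinate_cylinders)).
    exact: mB.
  exact: mC.
by rewrite -bigcapI.
Qed.

Lemma past_measurable m : (forall t, random_mx (P t)) -> past m `<=` measurable.
Proof.
move=> rP _ [B mB ->]; apply: fin_bigcap_measurable; first exact: finite_seq.
by move=> t _; exact: rP.
Qed.

(** On a cylinder [A], the intersection with the event on [P m] is again a cylinder, over the index
    list [m :: iota 0 m]; mutual independence applied to both lists gives the product. The family
    [D] inserts [C] at index [m]. *)
Lemma past_independent m (A : set Omega) (C : set 'M[R]_n) :
  iid_mx Pr P -> <<s past m >> A -> measurable_mx C ->
  Pr (A `&` P m @^-1` C) = Pr A * Pr (P m @^-1` C).
Proof.
move=> [rP _ iP] sA mC.
apply: (g_sigma_algebra_independent _ (@past_setI_closed m)) sA.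
- exact: past_measurable.
- exact: past_setT.
- exact: rP.
move=> _ [B mB ->].
have Um : uniq (m :: iota 0 m) by rewrite /= mem_iota/= add0n ltnn iota_uniq.
pose D t := if t == m then C else B t.
have mD t : measurable_mx (D t) by rewrite /D; case: ifP.
have DB t : t \in iota 0 m -> D t = B t.
  by rewrite mem_iota/= add0n /D => tm; rewrite ltn_eqF.
have EB : \bigcap_(t in [set` iota 0 m]) P t @^-1` B t =
          \bigcap_(t in [set` iota 0 m]) P t @^-1` D t.
  by apply: eq_bigcapr => t /= /DB ->.
have -> : \bigcap_(t in [set` iota 0 m]) P t @^-1` B t `&` P m @^-1` C =
          \bigcap_(t in [set` m :: iota 0 m]) P t @^-1` D t.
  by rewrite EB !bigcap_seq big_cons {2}/D eqxx setIC.
by rewrite EB !iP ?iota_uniq// big_cons {1}/D eqxx muleC.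
Qed.

Lemma expectation_past_prod m (u : 'M[R]_n -> R) (Y : Omega -> R) :
  iid_mx Pr P ->
  measurable_fun setT (u : g_sigma_algebraType coordinate_cylinders -> R) ->
  measurable_fun setT (Y : g_sigma_algebraType (past m) -> R) ->
  (forall M, 0 <= u M)%R -> (forall w, 0 <= Y w)%R ->
  'E_Pr[fun w => u (P m w) * Y w]%R = 'E_Pr[u \o P m] * 'E_Pr[Y].
Proof.
move=> iP mu mY u0 Y0; have [rP _ _] := iP.
have mX : measurable_fun setT (P m : Omega -> g_sigma_algebraType coordinate_cylinders).
  by move=> _ A mA; rewrite setTI; exact: rP.
(* The second random variable is the identity of Omega, with the
   sub-sigma-algebra of the past on its codomain. *)
have mI : measurable_fun setT (idfun : Omega -> g_sigma_algebraType (past m)).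
  move=> _ A mA; rewrite setTI preimage_id.
  have : <<s past m >> `<=` @measurable _ Omega; last exact.
  apply: smallest_sub; first exact: sigma_algebra_measurable.
  exact: past_measurable.
pose X' : {mfun Omega >-> g_sigma_algebraType coordinate_cylinders} :=
  mfun_Sub (mem_set mX).
pose I' : {mfun Omega >-> g_sigma_algebraType (past m)} :=
  mfun_Sub (mem_set mI).
apply: (@ge0_expectation_prod _ _ _ Pr _ _ _ _ X' I' u Y) => // A B mA mB.
by rewrite setIC [RHS]muleC; exact: past_independent.
Qed.

End Past.

(** * Doubly stochastic matrices and their distance to the uniform matrix *)

Section DoublyStochastic.
Context {R : realType} {n : nat}.
Implicit Types (M Q W : 'M[R]_n).

(** The difference of the two sides is a variance. *)
Lemma sqr_mean_le (I : finType) (p x : I -> R) :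
  (forall k, 0 <= p k) -> \sum_k p k = 1 ->
  (\sum_k p k * x k) ^+ 2 <= \sum_k p k * x k ^+ 2.
Proof.
move=> p0 p1; set m := \sum_k p k * x k.
rewrite -subr_ge0; have -> : \sum_k p k * x k ^+ 2 - m ^+ 2 =
    \sum_k p k * (x k - m) ^+ 2.
  transitivity (\sum_k (p k * x k ^+ 2 - 2 * m * (p k * x k) + m ^+ 2 * p k)).
    rewrite big_split/= sumrB -!mulr_sumr -/m p1; ring.
  by apply: eq_bigr => k _; ring.
by apply: sumr_ge0 => k _; rewrite mulr_ge0// sqr_ge0.
Qed.

Lemma doubly_stochastic1 : doubly_stochastic (1%:M : 'M[R]_n).
Proof.
split=> [i j|i|j]; first by rewrite mxE ler0n.
- by rewrite (bigD1 i)//= mxE eqxx big1 ?addr0// => j ji; rewrite mxE eq_sym (negbTE ji).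
- by rewrite (bigD1 j)//= mxE eqxx big1 ?addr0// => i ij; rewrite mxE (negbTE ij).
Qed.

Lemma doubly_stochasticM Q M : doubly_stochastic Q -> doubly_stochastic M ->
  doubly_stochastic (Q *m M).
Proof.
move=> [Q0 Qr Qc] [M0 Mr Mc]; split=> [i j|i|j].
- by rewrite mxE sumr_ge0// => k _; rewrite mulr_ge0.
- under eq_bigr do rewrite mxE.
  rewrite exchange_big/= -[RHS](Qr i); apply: eq_bigr => k _.
  by rewrite -mulr_sumr Mr mulr1.
- under eq_bigr do rewrite mxE.
  rewrite exchange_big/= -[RHS](Mc j); apply: eq_bigr => k _.
  by rewrite -mulr_suml Qc mul1r.
Qed.

Lemma doubly_stochastic_le1 M i j : doubly_stochastic M -> M i j <= 1.
Proof.
by move=> [M0 Mr _]; rewrite -(Mr i) (bigD1 j)//= lerDl sumr_ge0.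
Qed.

(* The spectral gap of E[P^T P] controls the columns of the products of the P(t)
   whereas the algorithm involves their rows: the Frobenius norm bounds both. *)
Definition consensus_error M : R :=
  \sum_(i < n) \sum_(j < n) (M i j - n%:R^-1) ^+ 2.

Lemma consensus_error_ge0 M : 0 <= consensus_error M.
Proof. by do 2 (apply: sumr_ge0 => ? _); exact: sqr_ge0. Qed.

Let J : 'M[R]_n := const_mx n%:R^-1.

Lemma consensus_errorE M : consensus_error M = \tr ((M - J)^T *m (M - J)).
Proof.
rewrite /consensus_error exchange_big; apply: eq_bigr => j _.
by rewrite mxE; apply: eq_bigr => i _; rewrite !mxE expr2.
Qed.

(** [Q] fixes constant columns, so it averages the entries of each column of [M - J]. Jensen's
    inequality uses the row sums of [Q], and summing over the rows uses its column sums. *)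
Lemma consensus_errorM Q M : doubly_stochastic Q ->
  consensus_error (Q *m M) <= consensus_error M.
Proof.
move=> [Q0 Qr Qc]; rewrite /consensus_error.
rewrite exchange_big [leRHS]exchange_big; apply: ler_sum => j _.
apply: (@le_trans _ _ (\sum_i \sum_k Q i k * (M k j - n%:R^-1) ^+ 2)).
  apply: ler_sum => i _; apply: le_trans (sqr_mean_le _ (Q0 i) (Qr i)).
  rewrite le_eqVlt; apply/orP; left; apply/eqP; congr (_ ^+ 2).
  rewrite mxE; under [RHS]eq_bigr do rewrite mulrBr.
  by rewrite sumrB -mulr_suml Qr mul1r.
rewrite exchange_big; apply: ler_sum => k _.
by rewrite -mulr_suml Qc mul1r.
Qed.

Lemma norm1_row_le2 M i : (0 < n)%N -> doubly_stochastic M ->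
  \sum_j `|M i j - n%:R^-1| <= 2.
Proof.
move=> n0 [M0 Mr Mc].
apply: (@le_trans _ _ (\sum_j (M i j + n%:R^-1))).
  apply: ler_sum => j _; apply: le_trans (ler_normB _ _) _.
  by rewrite !ger0_norm// invr_ge0.
rewrite big_split/= Mr sumr_const card_ord -[_ *+ n]mulr_natr mulVf//.
by rewrite pnatr_eq0 -lt0n.
Qed.

(** Cauchy-Schwarz, in the form of [sqr_mean_le] with uniform weights, followed by bounding one row
    by the whole Frobenius norm. *)
Lemma norm1_row_le_error M i : (0 < n)%N ->
  \sum_j `|M i j - n%:R^-1| <= Num.sqrt (n%:R * consensus_error M).
Proof.
move=> n0; have nn0 : n%:R != 0 :> R by rewrite pnatr_eq0 -lt0n.
have p1 : \sum_(j < n) n%:R^-1 = 1 :> R.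
  by rewrite sumr_const card_ord -[_ *+ n]mulr_natr mulVf.
have := @sqr_mean_le _ (fun=> n%:R^-1) (fun j => `|M i j - n%:R^-1|) _ p1.
rewrite -!mulr_sumr exprMn => /(_ (fun=> _)) sq.
rewrite -[leLHS]ger0_norm ?sumr_ge0// -sqrtr_sqr; apply: ler_wsqrtr.
rewrite -(@ler_pM2l _ (n%:R^-1 ^+ 2)) ?exprn_gt0 ?invr_gt0 ?ltr0n//.
apply: le_trans (sq _) _ => [|]; first by rewrite invr_ge0.
rewrite expr2 -!mulrA ler_wpM2l ?invr_ge0// mulKf//.
under eq_bigr do rewrite -normrX ger0_norm ?sqr_ge0//.
pose F k := \sum_(j < n) (M k j - n%:R^-1) ^+ 2.
suff : F i <= \sum_k F k by [].
rewrite (bigD1 i)//= lerDl sumr_ge0// => k _.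
by apply: sumr_ge0 => j _; exact: sqr_ge0.
Qed.

(** [J] absorbs [W] and [M], so every cross term collapses to [J], whose trace is 1. *)
Lemma tr_doubly_stochastic_form W M : (0 < n)%N ->
  W^T = W -> const_mx 1 *m W = const_mx 1 :> 'rV_n -> doubly_stochastic M ->
  \tr (M^T *m W *m M) = \tr ((M - J)^T *m W *m (M - J)) + 1.
Proof.
move=> n0 symW W1 [M0 Mr Mc].
have nn0 : n%:R != 0 :> R by rewrite pnatr_eq0 -lt0n.
have JW : J *m W = J.
  apply/matrixP => i j; rewrite !mxE; move/matrixP: W1 => /(_ 0 j); rewrite !mxE.
  under eq_bigr do rewrite mxE mul1r.
  by under [in X in _ -> X]eq_bigr do rewrite mxE; rewrite -mulr_sumr => ->; rewrite mulr1.
have JT : J^T = J by rewrite trmx_const.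
have WJ : W *m J = J by rewrite -[LHS]trmxK trmx_mul JT symW JW.
have JM : J *m M = J.
  apply/matrixP => i j; rewrite !mxE.
  by under eq_bigr do rewrite mxE; rewrite -mulr_sumr Mc mulr1.
have MJ : M^T *m J = J by rewrite -[LHS]trmxK trmx_mul JT trmxK JM.
have JJ : J *m J = J.
  apply/matrixP => i j; rewrite !mxE.
  under eq_bigr do rewrite !mxE.
  by rewrite sumr_const card_ord -[_ *+ n]mulr_natr -mulrA mulVf// mulr1.
have trJ : \tr J = 1.
  rewrite /mxtrace; under eq_bigr do rewrite !mxE.
  by rewrite sumr_const card_ord -[_ *+ n]mulr_natr mulVf.
rewrite [(M - J)^T]raddfB/= JT !mulmxBl !mulmxBr JW -[M^T *m W *m J]mulmxA WJ MJ JM JJ subrr subr0.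
by rewrite [in RHS]raddfB/= trJ subrK.
Qed.

Lemma second_moment_error M : (0 < n)%N -> doubly_stochastic M ->
  \sum_i \sum_j M i j ^+ 2 = consensus_error M + 1.
Proof.
move=> n0 dM; rewrite consensus_errorE -[(M - J)^T]mulmx1.
rewrite -tr_doubly_stochastic_form ?trmx1 ?mulmx1//.
rewrite exchange_big; apply: eq_bigr => j _.
by rewrite mxE; apply: eq_bigr => i _; rewrite !mxE expr2.
Qed.

(** Cyclicity of the trace separates the newest matrix [Q] from the older product [M]; in the
    application the two factors of each term are independent. *)
Lemma second_moment_mulmx Q M : \sum_i \sum_j (Q *m M) i j ^+ 2 =
  \sum_a \sum_b (Q^T *m Q) a b * (M *m M^T) a b.
Proof.
transitivity (\tr ((Q *m M)^T *m (Q *m M))).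
  rewrite exchange_big; apply: eq_bigr => j _.
  by rewrite mxE; apply: eq_bigr => i _; rewrite !mxE expr2.
rewrite trmx_mul -mulmxA mxtrace_mulC !mulmxA -(mulmxA (Q^T *m Q)); apply: eq_bigr => a _.
rewrite [LHS]mxE; apply: eq_bigr => b _. congr (_ * _).
by rewrite !mxE; apply: eq_bigr => c _; rewrite !mxE mulrC.
Qed.

(** The trace is a sum of quadratic forms over the columns of [M - J]. Each column sums to 0, so the
    second eigenvalue bounds its form. *)
Lemma spectral_gap W M : (0 < n)%N ->
  W^T = W -> const_mx 1 *m W = const_mx 1 :> 'rV_n -> lambda 2 W < 1 ->
  doubly_stochastic M ->
  \sum_a \sum_b W a b * (M *m M^T) a b <= 1 + lambda 2 W * consensus_error M.
Proof.
move=> n0 symW W1 lamW dM; have [M0 Mr Mc] := dM.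
have -> : \sum_a \sum_b W a b * (M *m M^T) a b = \tr (M^T *m W *m M).
  rewrite -mulmxA mxtrace_mulC /mxtrace; apply: eq_bigr => a _.
  rewrite -mulmxA [RHS]mxE; apply: eq_bigr => b _; congr (_ * _).
  by rewrite !mxE; apply: eq_bigr => c _; rewrite !mxE mulrC.
rewrite tr_doubly_stochastic_form// addrC lerD2l consensus_errorE mulr_sumr.
apply: ler_sum => c _; set U := M - J.
have := @quadratic_form_le_lambda2 _ _ W (row c U^T) symW W1 lamW.
rewrite !tr_row trmxK -!row_mul.
have rc (A B : 'M[R]_n) : row c (A *m col c B) 0 0 = (A *m B) c c.
  by rewrite !mxE; apply: eq_bigr => k _; rewrite !mxE.
rewrite !rc; apply; apply/matrixP => i j.
rewrite !mxE; under eq_bigr do rewrite !mxE mulr1.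
rewrite sumrB Mc sumr_const card_ord -[_ *+ n]mulr_natr mulVf ?subrr//.
by rewrite pnatr_eq0 -lt0n.
Qed.

End DoublyStochastic.

(** * Products of consecutive matrices and the decay of their expected error *)

Fixpoint transition (R : realType) n (P : nat -> 'M[R]_n) (s k : nat) : 'M[R]_n :=
  if k is k'.+1 then P (s + k)%N *m transition P s k' else 1%:M.

Lemma doubly_stochastic_transition (R : realType) n (P : nat -> 'M[R]_n) s k :
  (forall t, doubly_stochastic (P t)) -> doubly_stochastic (transition P s k).
Proof.
move=> dP; elim: k => [|k IH] /=; first exact: doubly_stochastic1.
exact: doubly_stochasticM.
Qed.

Section ErrorDecay.
Context {R : realType} {n : nat} {disp : measure_display}
  {Omega : measurableType disp} (Pr : probability Omega R)
  (P : nat -> Omega -> 'M[R]_n).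
Hypothesis P_iid : iid_mx Pr P.
Hypothesis P_stochastic : forall t w, doubly_stochastic (P t w).
Hypothesis n_gt0 : (0 < n)%N.

Lemma bounded_Lfun1 (X : Omega -> R) (C : R) : measurable_fun setT X ->
  (forall w, `|X w| <= C) -> X \in Lfun Pr 1.
Proof.
move=> mX XC; rewrite inE; apply/Lfun1_integrable.
apply: measurable_bounded_integrable => //.
  by rewrite ltey_eq; apply/orP; left; exact: fin_num_measure.
exists C; split; first exact: num_real.
by move=> x Cx w _; apply: le_trans (XC w) _; exact: ltW.
Qed.

Lemma measurable_coordinate i j :
  measurable_fun setT
    ((fun M : 'M[R]_n => M i j) : g_sigma_algebraType coordinate_cylinders -> R).
Proof.
move=> _ B mB; rewrite setTI; apply: sub_sigma_algebra.
by exists i, j, B.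
Qed.

Lemma measurable_past_entry m t i j : (t < m)%N ->
  measurable_fun setT ((fun w => P t w i j) : g_sigma_algebraType (past P m) -> R).
Proof.
move=> tm _ B mB; rewrite setTI; apply: sub_sigma_algebra.
apply: (@past_preimage _ _ _ _ P m t [set M : 'M[R]_n | B (M i j)]) => //.
by apply: sub_sigma_algebra; exists i, j, B.
Qed.

Lemma measurable_past_transition m s k i j : (s + k < m)%N ->
  measurable_fun setT ((fun w => transition (P ^~ w) s k i j)
    : g_sigma_algebraType (past P m) -> R).
Proof.
elim: k i j => [|k IH] i j /= skm; first exact: measurable_cst.
under eq_fun do rewrite mxE.
apply: measurable_sum => l; apply: measurable_funM.
  exact: measurable_past_entry.
by apply: IH; apply: leq_ltn_trans skm; rewrite leq_add2l.
Qed.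

Lemma past_measurable_fun m (X : Omega -> R) :
  measurable_fun setT (X : g_sigma_algebraType (past P m) -> R) ->
  measurable_fun setT X.
Proof.
have [rP _ _] := P_iid.
move=> mX _ B mB; have := mX measurableT B mB.
have : <<s past P m >> `<=` @measurable _ Omega; last exact.
by apply: smallest_sub; [exact: sigma_algebra_measurable|exact: past_measurable].
Qed.

Lemma expectation_identically_distributed (u : 'M[R]_n -> R) s t :
  measurable_fun setT (u : g_sigma_algebraType coordinate_cylinders -> R) ->
  (forall M, 0 <= u M) -> ('E_Pr[u \o P s] = 'E_Pr[u \o P t])%E.
Proof.
move=> mu u0; have [rP dP _] := P_iid.
have mP r : measurable_fun setT (P r : Omega -> g_sigma_algebraType coordinate_cylinders).
  by move=> _ A mA; rewrite setTI; exact: rP.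
pose X r : {mfun Omega >-> g_sigma_algebraType coordinate_cylinders} :=
  mfun_Sub (mem_set (mP r)).
have EX r : ('E_Pr[u \o P r] = \int[distribution Pr (X r)]_x (u x)%:E)%E.
  rewrite unlock ge0_integral_distribution//; first exact/measurable_EFinP.
rewrite !EX; apply: eq_measure_integral => A mA _.
exact: dP.
Qed.

Definition mixing_error s k (w : Omega) := consensus_error (transition (P ^~ w) s k).

Lemma measurable_mixing_error s k : measurable_fun setT (mixing_error s k).
Proof.
rewrite /mixing_error /consensus_error.
apply: measurable_sum => i; apply: measurable_sum => j.
apply: measurable_funX; apply: measurable_funB => //.
by apply: past_measurable_fun; apply: measurable_past_transition; exact: ltnSn.
Qed.

Lemma doubly_stochastic_gram t w : doubly_stochastic ((P t w)^T *m P t w).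
Proof.
apply: doubly_stochasticM => //.
have [P0 Pr' Pc] := P_stochastic t w.
by split=> [i j|i|j]; rewrite ?mxE//; under eq_bigr do rewrite mxE.
Qed.

Lemma mixing_error_le s k w : 0 <= mixing_error s k w <= n%:R ^+ 2.
Proof.
rewrite consensus_error_ge0/=.
have dM := @doubly_stochastic_transition _ _ (P ^~ w) s k (P_stochastic^~ w).
rewrite -(lerD2r 1) -second_moment_error//.
apply: (@le_trans _ _ (\sum_(i < n) \sum_(j < n) 1)).
  do 2 (apply: ler_sum => ? _); have [M0 _ _] := dM.
  by rewrite expr_le1//; exact: doubly_stochastic_le1.
by rewrite !sumr_const !card_ord -mulrnA natrM expr2 lerDl.
Qed.

Let W := expectation_mx Pr (fun w => (P 0 w)^T *m P 0 w).

(** The absolute value makes the function nonnegative on all matrices, as [expectation_past_prod]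
    demands; on the doubly stochastic [P t w] it changes nothing. *)
Let gram a b (M : 'M[R]_n) : R := `|(M^T *m M) a b|.

Let gramE t w a b : gram a b (P t w) = ((P t w)^T *m P t w) a b.
Proof. by rewrite /gram ger0_norm//; have [] := doubly_stochastic_gram t w. Qed.

Let measurable_gram a b : measurable_fun setT
  (gram a b : g_sigma_algebraType coordinate_cylinders -> R).
Proof.
apply: (@measurableT_comp _ _ _ _ _ _ (fun x : R => `|x|)) => //.
under eq_fun do rewrite mxE; apply: measurable_sum => c.
under eq_fun do rewrite mxE.
by apply: measurable_funM; exact: measurable_coordinate.
Qed.

Let gram_Lfun1 t a b : (gram a b \o P t) \in Lfun Pr 1.
Proof.
apply: (@bounded_Lfun1 _ 1).
  have [rP _ _] := P_iid.
  apply: (measurableT_comp (measurable_gram a b)).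
  by move=> _ A mA; rewrite setTI; exact: rP.
move=> w /=; rewrite gramE; have dG := doubly_stochastic_gram t w.
by have [G0 _ _] := dG; rewrite ger0_norm//; exact: doubly_stochastic_le1.
Qed.

Let expectation_gram t a b : ('E_Pr[gram a b \o P t] = (W a b)%:E)%E.
Proof.
rewrite (@expectation_identically_distributed _ t 0%N (measurable_gram a b)); last first.
  by move=> M; exact: normr_ge0.
rewrite mxE -[LHS]fineK ?expectation_fin_num//.
by congr ((fine 'E_Pr[ _ ])%:E); apply/funext => w /=; rewrite gramE.
Qed.

Let W_sym : W^T = W.
Proof.
apply/matrixP => a b; apply: EFin_inj; rewrite mxE -!(expectation_gram 0).
congr ('E_Pr[ _ ])%E; apply/funext => w /=.
rewrite !gramE -[in LHS](trmxK (P 0 w)) -trmx_mul trmxK.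
by rewrite mxE.
Qed.

Let W_ge0 a b : 0 <= W a b.
Proof.
by rewrite -lee_fin -(expectation_gram 0) expectation_ge0// => w /=; rewrite normr_ge0.
Qed.

Let W_row1 : const_mx 1 *m W = const_mx 1 :> 'rV_n.
Proof.
apply/rowP => b; rewrite !mxE; apply: EFin_inj; rewrite -sumEFin.
under eq_bigr do rewrite mxE mul1r -(expectation_gram 0).
transitivity ('E_Pr[(\sum_(a < n) (gram a b \o P 0))%R])%E.
  rewrite -(big_map (fun a => gram a b \o P 0) xpredT id) expectation_sum.
    by rewrite big_map.
  by move=> X /mapP[a _ ->].
rewrite -[RHS](expectation_cst Pr); congr ('E_Pr[ _ ])%E; apply/funext => w /=.
rewrite fct_sumE; have [_ _ /(_ b) <-] := doubly_stochastic_gram 0 w.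
by apply: eq_bigr => a _; rewrite /= gramE.
Qed.

Lemma expectation_fin_sum (I : finType) (X : I -> Omega -> R) :
  (forall i, X i \in Lfun Pr 1) ->
  ('E_Pr[fun w => (\sum_i X i w)%R] = \sum_i 'E_Pr[X i])%E.
Proof.
move=> X1; rewrite -(big_map X xpredT (fun Y => 'E_Pr[Y]%E)) -expectation_sum.
  congr ('E_Pr[ _ ])%E; apply/funext => w.
  by rewrite big_map fct_sumE.
by move=> Y /mapP[i _ ->].
Qed.

Let cov s k a b w : R :=
  (transition (P ^~ w) s k *m (transition (P ^~ w) s k)^T) a b.

Let measurable_cov m s k a b : (s + k < m)%N ->
  measurable_fun setT (cov s k a b : g_sigma_algebraType (past P m) -> R).
Proof.
move=> skm; rewrite /cov; under eq_fun do rewrite mxE.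
apply: measurable_sum => c; under eq_fun do rewrite [_^T _ _]mxE.
by apply: measurable_funM; exact: measurable_past_transition.
Qed.

Let cov_bound s k a b w : 0 <= cov s k a b w <= 1.
Proof.
have dM := @doubly_stochastic_transition _ _ (P ^~ w) s k (P_stochastic^~ w).
have dMM : doubly_stochastic (transition (P ^~ w) s k *m (transition (P ^~ w) s k)^T).
  apply: doubly_stochasticM => //; have [M0 Mr Mc] := dM.
  by split=> [i j|i|j]; rewrite ?mxE//; under eq_bigr do rewrite mxE.
by have [C0 _ _] := dMM; rewrite C0/=; exact: doubly_stochastic_le1.
Qed.

Let cov_Lfun1 s k a b : cov s k a b \in Lfun Pr 1.
Proof.
apply: (@bounded_Lfun1 _ 1).
  exact: past_measurable_fun (measurable_cov a b (ltnSn _)).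
by move=> w; have /andP[c0 c1] := cov_bound s k a b w; rewrite ger0_norm.
Qed.

Lemma mixing_error_Lfun1 s k : mixing_error s k \in Lfun Pr 1.
Proof.
apply: (@bounded_Lfun1 _ (n%:R ^+ 2)); first exact: measurable_mixing_error.
by move=> w; have /andP[e0 e1] := mixing_error_le s k w; rewrite ger0_norm.
Qed.

(** With 1 added, the error becomes the sum of the [X p], each a function of [P m] times a function
    of the past of [m]. By independence [X p] has the same expectation as [Y p], where [W] stands
    for the Gram matrix, and [spectral_gap] bounds the sum of the [Y p] at every sample point. *)
Lemma expectation_mixing_error_step s k : lambda 2 W < 1 ->
  ('E_Pr[mixing_error s k.+1] <= (lambda 2 W)%:E * 'E_Pr[mixing_error s k])%E.
Proof.
move=> lamW.
have dM k' w := @doubly_stochastic_transition _ _ (P ^~ w) s k' (P_stochastic^~ w).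
pose m := (s + k.+1)%N.
pose X (p : 'I_n * 'I_n) w := gram p.1 p.2 (P m w) * cov s k p.1 p.2 w.
pose Y (p : 'I_n * 'I_n) w := W p.1 p.2 * cov s k p.1 p.2 w.
have XE w : mixing_error s k.+1 w + 1 = \sum_p X p w.
  rewrite /mixing_error -(second_moment_error n_gt0 (dM k.+1 w)).
  rewrite second_moment_mulmx pair_big/=; apply: eq_bigr => p _.
  by rewrite /X gramE.
have YE w : \sum_p Y p w <= lambda 2 W * mixing_error s k w + 1.
  rewrite addrC; apply: le_trans (spectral_gap n_gt0 W_sym W_row1 lamW (dM k w)).
  by rewrite pair_big.
have X1 p : X p \in Lfun Pr 1.
  apply: (@bounded_Lfun1 _ 1).
    apply: measurable_funM.
      have [rP _ _] := P_iid.
      apply: (measurableT_comp (measurable_gram p.1 p.2)).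
      by move=> _ A mA; rewrite setTI; exact: rP.
    exact: past_measurable_fun (measurable_cov p.1 p.2 (ltnSn _)).
  move=> w; have /andP[c0 c1] := cov_bound s k p.1 p.2 w.
  have dG := doubly_stochastic_gram m w; have [G0 _ _] := dG.
  rewrite ger0_norm /X gramE ?mulr_ge0//.
  by rewrite mulr_ile1//; exact: doubly_stochastic_le1.
have Y1 p : Y p \in Lfun Pr 1.
  rewrite (_ : Y p = W p.1 p.2 *: cov s k p.1 p.2)//.
  by rewrite rpredZ.
have EXY p : ('E_Pr[X p] = 'E_Pr[Y p])%E.
  rewrite /X (@expectation_past_prod _ _ _ _ Pr P m (gram p.1 p.2) (cov s k p.1 p.2))//.
  - rewrite expectation_gram -expectationZl//; congr ('E_Pr[ _ ])%E.
    by apply/funext => w /=; rewrite /Y mulrC.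
  - by apply: measurable_cov; rewrite /m addnS.
  - by move=> M; exact: normr_ge0.
  - by move=> w; have /andP[] := cov_bound s k p.1 p.2 w.
have c1 : cst 1 \in Lfun Pr 1 by apply: (@bounded_Lfun1 _ 1) => // w; rewrite normr1.
have E1 : ('E_Pr[mixing_error s k.+1] + 1 = \sum_p 'E_Pr[Y p])%E.
  rewrite -(eq_bigr _ (fun p _ => EXY p)) -expectation_fin_sum//.
  rewrite -[X in (_ + X)%E](expectation_cst Pr 1) -expectationD//; last exact: mixing_error_Lfun1.
  by congr ('E_Pr[ _ ])%E; apply/funext => w; rewrite -XE.
have : (\sum_p 'E_Pr[Y p] <= (lambda 2 W)%:E * 'E_Pr[mixing_error s k] + 1)%E.
  rewrite -expectation_fin_sum// -[X in (_ + X)%E](expectation_cst Pr 1).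
  rewrite -expectationZl ?mixing_error_Lfun1// -expectationD//; last first.
    rewrite (_ : _ \o* _ = lambda 2 W *: mixing_error s k).
      by rewrite rpredZ// mixing_error_Lfun1.
    by apply/funext => w /=; rewrite mulrC.
  apply: expectation_le.
  - apply: measurable_sum => p; apply: measurable_funM => //.
    exact: past_measurable_fun (measurable_cov p.1 p.2 (ltnSn _)).
  - apply: measurable_funD => //; apply: measurable_funM => //.
    exact: measurable_mixing_error.
  - move=> w; apply: sumr_ge0 => p _; rewrite mulr_ge0//.
    by have /andP[] := cov_bound s k p.1 p.2 w.
  - move=> w; rewrite /= [X in X + 1]mulrC; apply: le_trans (YE w).
    apply: sumr_ge0 => p _; rewrite mulr_ge0//.
    by have /andP[] := cov_bound s k p.1 p.2 w.
  - by apply: aeW => w; rewrite /= [X in X + 1]mulrC.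
by rewrite -E1 leeD2rE.
Qed.

(** The empty product is the identity, whose error is n - 1. The maximum with 0 keeps the factor
    nonnegative, so that the one-step bounds can be multiplied. *)
Lemma expectation_mixing_error_le s k : lambda 2 W < 1 ->
  ('E_Pr[mixing_error s k] <= (Num.max 0 (lambda 2 W) ^+ k * n%:R)%:E)%E.
Proof.
move=> lamW; elim: k => [|k IH].
  rewrite expr0 mul1r -(expectation_cst Pr); apply: expectation_le => //.
  - exact: measurable_mixing_error.
  - by move=> w; exact: consensus_error_ge0.
  apply: aeW => w /=; rewrite /mixing_error /=.
  rewrite -(lerD2r 1) -(second_moment_error n_gt0 doubly_stochastic1).
  rewrite (eq_bigr (fun=> 1)) ?sumr_const ?card_ord ?lerDl// => i _.
  rewrite (bigD1 i)//= mxE eqxx expr1n big1 ?addr0// => j ji.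
  by rewrite mxE eq_sym (negbTE ji) expr0n.
apply: le_trans (expectation_mixing_error_step s k lamW) _.
rewrite exprS -mulrA EFinM.
apply: (@le_trans _ _ ((Num.max 0 (lambda 2 W))%:E * 'E_Pr[mixing_error s k])%E).
  apply: lee_wpmul2r; last by rewrite lee_fin le_max lexx orbT.
  by apply: expectation_ge0 => w; exact: consensus_error_ge0.
by apply: lee_wpmul2l => //; rewrite lee_fin le_max lexx.
Qed.

(* Markov's inequality for the sum of the T errors replaces a union bound. *)
Lemma mixing_errors_small_probability T k (eps : R) : lambda 2 W < 1 -> 0 < eps ->
  with_probability_ge Pr
    (1 - T%:R * (Num.max 0 (lambda 2 W) ^+ k * n%:R) / eps)
    [set w | forall s, (s < T)%N -> mixing_error s k w <= eps].
Proof.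
move=> lamW eps0; pose S w := \sum_(s < T) mixing_error s k w.
have mS : measurable_fun setT S by apply: measurable_sum => s; exact: measurable_mixing_error.
have S0 w : 0 <= S w by apply: sumr_ge0 => s _; exact: consensus_error_ge0.
have mA : measurable [set w | eps%:E <= `| (S w)%:E |]%E.
  rewrite -[X in measurable X]setTI; apply: emeasurable_fun_c_infty => //.
  by apply: measurableT_comp => //; exact/measurable_EFinP.
exists (~` [set w | (eps%:E <= `| (S w)%:E |)%E]); split.
- exact: measurableC.
- move=> w /= /negP; rewrite -ltNge lte_fin ger0_norm// => Se s sT.
  apply: ltW; apply: le_lt_trans Se.
  rewrite /S (bigD1 (Ordinal sT))//= lerDl sumr_ge0// => s' _.
  exact: consensus_error_ge0.
rewrite probability_setC// EFinB leeB//.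
rewrite EFinM lee_pdivlMr// muleC -[X in Pr X]setTI.
apply: le_trans.
  by apply: (le_integral_abse _ measurableT _ eps0); exact/measurable_EFinP.
have -> : (\int[Pr]_w `|(EFin \o S) w| = 'E_Pr[S])%E.
  by rewrite unlock; apply: eq_integral => w _ /=; rewrite ger0_norm.
rewrite expectation_fin_sum; last by move=> s; exact: mixing_error_Lfun1.
apply: (@le_trans _ _
    (\sum_(s < T) (Num.max 0 (lambda 2 W) ^+ k * n%:R)%:E)%E).
  by apply: lee_sum => s _; exact: expectation_mixing_error_le.
by rewrite sumEFin sumr_const card_ord mulr_natl.
Qed.

End ErrorDecay.

(** * Arbitrary norms on R^d and bounds in the dual norm *)

Lemma lipschitz_bound_continuous (R : realType) (V : normedModType R)
    (f : V -> R) (C : R) :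
  0 <= C -> (forall u v, f u - f v <= C * `|u - v|) -> continuous f.
Proof.
move=> C0 fC u; have C1 : 0 < C + 1 by rewrite ltr_wpDl.
apply/cvgrPdist_le => e e0; apply/nbhs_normP; exists (e / (C + 1)).
  exact: divr_gt0.
move=> v /= uv; have {}uv : C * `|u - v| <= e.
  apply: (@le_trans _ _ ((C + 1) * `|u - v|)).
    by rewrite ler_wpM2r// lerDl.
  by rewrite mulrC -ler_pdivlMr//; exact: ltW.
rewrite ler_norml lerNl opprB; apply/andP; split; apply: le_trans (fC _ _) _ => //.
by rewrite distrC.
Qed.

Section Norms.
Context {R : realType} {d : nat}.
Implicit Types (u v w : 'rV[R]_d) (N : 'rV[R]_d -> R).

Lemma dotDl u v w : dot (u + v) w = dot u w + dot v w.
Proof.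
by rewrite -big_split; apply: eq_bigr => k _; rewrite mxE mulrDl.
Qed.

Lemma dotDr u v w : dot w (u + v) = dot w u + dot w v.
Proof.
by rewrite -big_split; apply: eq_bigr => k _; rewrite mxE mulrDr.
Qed.

Lemma dotZl a u v : dot (a *: u) v = a * dot u v.
Proof. by rewrite mulr_sumr; apply: eq_bigr => k _; rewrite mxE mulrA. Qed.

Lemma dotZr a u v : dot u (a *: v) = a * dot u v.
Proof. by rewrite mulr_sumr; apply: eq_bigr => k _; rewrite mxE mulrCA. Qed.

Lemma dotNl u v : dot (- u) v = - dot u v.
Proof. by rewrite -scaleN1r dotZl mulN1r. Qed.

Lemma dotNr u v : dot u (- v) = - dot u v.
Proof. by rewrite -scaleN1r dotZr mulN1r. Qed.

Lemma dot0l u : dot 0 u = 0.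
Proof. by rewrite -(scale0r 0) dotZl mul0r. Qed.

Lemma dot0r u : dot u 0 = 0.
Proof. by rewrite -(scale0r 0) dotZr mul0r. Qed.

Lemma dot_suml (I : Type) (r : seq I) (Q : pred I) (F : I -> 'rV[R]_d) v :
  dot (\sum_(i <- r | Q i) F i) v = \sum_(i <- r | Q i) dot (F i) v.
Proof. by elim/big_rec2: _ => [|i y x _ <-]; rewrite ?dot0l ?dotDl. Qed.

Lemma is_normN N u : is_norm N -> N (- u) = N u.
Proof. by move=> [_ NZ _]; rewrite -scaleN1r NZ normrN1 mul1r. Qed.

Lemma is_norm0 N : is_norm N -> N 0 = 0.
Proof. by move=> [_ NZ _]; rewrite -(scale0r 0) NZ normr0 mul0r. Qed.

Lemma is_norm_ge0 N u : is_norm N -> 0 <= N u.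
Proof.
move=> nN; have [ND _ _] := nN; have := ND u (- u).
by rewrite subrr is_norm0// is_normN// -mulr2n pmulrn_lge0.
Qed.

Lemma is_norm_distC N u v : is_norm N -> N (u - v) = N (v - u).
Proof. by move=> nN; rewrite -[in RHS]is_normN// opprB. Qed.

Lemma is_norm_sum_le N (I : Type) (r : seq I) (F : I -> 'rV[R]_d) :
  is_norm N -> N (\sum_(i <- r) F i) <= \sum_(i <- r) N (F i).
Proof.
move=> nN; have [ND _ _] := nN.
elim/big_rec2: _ => [|i y x _ yx]; first by rewrite is_norm0.
by apply: le_trans (ND _ _) _; rewrite lerD2l.
Qed.

Lemma coord_le_mx_norm u k : `|u 0 k| <= `|u|.
Proof.
rewrite [leRHS]/Num.norm/= mx_normrE.
by apply: (le_bigmax _ (fun ij => `|u ij.1 ij.2|) (0, k)).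
Qed.

Lemma norm_le_mx_norm N : is_norm N ->
  exists2 C, 0 <= C & forall u, N u <= C * `|u|.
Proof.
move=> nN; have [ND NZ _] := nN.
exists (\sum_k N (delta_mx 0 k)).
  by apply: sumr_ge0 => k _; exact: is_norm_ge0.
move=> u; rewrite {1}(row_sum_delta u); apply: le_trans (is_norm_sum_le _ _ nN) _.
rewrite mulr_suml; apply: ler_sum => k _.
by rewrite NZ mulrC ler_wpM2l ?is_norm_ge0// coord_le_mx_norm.
Qed.

Lemma is_norm_continuous N : is_norm N -> continuous N.
Proof.
move=> nN; have [C C0 NC] := norm_le_mx_norm nN; have [ND _ _] := nN.
apply: (@lipschitz_bound_continuous R 'rV[R]_d N C C0) => u v.
rewrite lerBlDr -{1}(subrK v u); apply: le_trans (ND _ _) _.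
by rewrite lerD2r.
Qed.

(** [N] is continuous and positive on the compact unit sphere of the library norm, so its minimum
    there is positive. The sphere is empty only if every vector is 0. *)
Lemma mx_norm_le_norm N : is_norm N ->
  exists2 C, 0 <= C & forall u, `|u| <= C * N u.
Proof.
move=> nN; have [ND NZ N0] := nN.
have [[u0 u01]|S0] := pselect (exists u : 'rV[R]_d, `|u| = 1); last first.
  exists 0 => // u; rewrite mul0r normr_le0; apply: contrapT => /negP u0.
  by apply: S0; exists (`|u|^-1 *: u); rewrite normrZ normfV normr_id mulVf ?normr_eq0.
have cS : compact [set u : 'rV[R]_d | `|u| = 1].
  apply: bounded_closed_compact.
    exists 1; split; first exact: num_real.
    by move=> M M1 u /= ->; exact: ltW.
  rewrite (_ : mkset _ = Num.norm @^-1` [set 1])//.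
  by apply: closed_comp => [u _|]; [exact: norm_continuous|exact: closed_eq].
have [c cS1 cmin] := @EVT_min_rV R _ N _ (ex_intro _ u0 u01) cS
  (continuous_subspaceT (is_norm_continuous nN)).
rewrite inE /= in cS1.
have Nc : 0 < N c.
  rewrite lt_neqAle is_norm_ge0// andbT; apply/eqP => /esym/N0 c0.
  by move: cS1; rewrite c0 normr0 => /eqP; rewrite eq_sym oner_eq0.
exists (N c)^-1; first by rewrite invr_ge0 ltW.
move=> u; have [->|u_neq0] := eqVneq u 0; first by rewrite normr0 is_norm0// mulr0.
have un : 0 < `|u| by rewrite normr_gt0.
rewrite mulrC ler_pdivlMr// mulrC -ler_pdivlMr// mulrC.
have := cmin (`|u|^-1 *: u); rewrite NZ normfV normr_id; apply.
by rewrite inE /= normrZ normfV normr_id mulVf ?gt_eqF.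
Qed.

(** A dual-norm bound stated without the supremum, so that it passes to sums and multiples with no
    boundedness condition. *)
Definition dual_le N v C := forall u, dot v u <= C * N u.

Lemma dual_leP N v : is_norm N -> exists2 C, 0 <= C & dual_le N v C.
Proof.
move=> nN; have [C C0 NC] := mx_norm_le_norm nN.
exists ((\sum_k `|v 0 k|) * C).
  by rewrite mulr_ge0// sumr_ge0.
move=> u; rewrite -mulrA; apply: (@le_trans _ _ ((\sum_k `|v 0 k|) * `|u|)).
  rewrite mulr_suml; apply: ler_sum => k _.
  by apply: le_trans (ler_norm _) _; rewrite normrM ler_wpM2l// coord_le_mx_norm.
by rewrite ler_wpM2l ?sumr_ge0.
Qed.

(** Homogeneity reduces to [N u = 1]; the equivalence of norms, through [dual_leP], shows that the
    supremum is over a bounded set and thus a genuine upper bound. *)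
Lemma dual_le_dual_norm N v : is_norm N -> dual_le N v (dual_norm N v).
Proof.
move=> nN u; have [_ NZ N0] := nN.
have [/N0->|Nu] := eqVneq (N u) 0; first by rewrite dot0r is_norm0// mulr0.
have Nu0 : 0 < N u by rewrite lt_neqAle eq_sym Nu is_norm_ge0.
rewrite -ler_pdivrMr// mulrC -dotZr.
have N1 : N ((N u)^-1 *: u) = 1 by rewrite NZ gtr0_norm ?invr_gt0// mulVf.
apply: sup_upper_bound; last by exists ((N u)^-1 *: u).
split; first by exists (dot v ((N u)^-1 *: u)); exists ((N u)^-1 *: u).
have [C C0 vC] := dual_leP v nN.
by exists C => _ [u' /= u'1 <-]; rewrite -[C]mulr1 -u'1.
Qed.

Lemma dual_norm_ge0 N v : is_norm N -> 0 <= dual_norm N v.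
Proof.
move=> nN; have [[u u1]|S0] := pselect (exists u, N u = 1).
  have := dual_le_dual_norm v nN u; have := dual_le_dual_norm v nN (- u).
  by rewrite dotNr is_normN// u1 mulr1; lra.
rewrite /dual_norm (_ : [set _ | _ in _] = set0) ?sup0//.
by apply/seteqP; split => // x [u u1 _]; apply: S0; exists u.
Qed.

Lemma dual_le_trans N v C C' : is_norm N -> C <= C' -> dual_le N v C -> dual_le N v C'.
Proof.
by move=> nN CC' vC u; apply: le_trans (vC u) _; rewrite ler_wpM2r// is_norm_ge0.
Qed.

Lemma dual_leZ N a v C : is_norm N -> dual_le N v C -> dual_le N (a *: v) (`|a| * C).
Proof.
move=> nN vC u; rewrite dotZl -mulrA.
have := vC u; have := vC (- u); rewrite dotNr is_normN// => v1 v2.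
have : `|dot v u| <= C * N u by rewrite ler_norml; lra.
by move=> ?; apply: le_trans (ler_norm _) _; rewrite normrM ler_wpM2l.
Qed.

Lemma dual_le_sum N (I : Type) (r : seq I) (F : I -> 'rV[R]_d) (C : I -> R) :
  (forall i, dual_le N (F i) (C i)) ->
  dual_le N (\sum_(i <- r) F i) (\sum_(i <- r) C i).
Proof.
move=> FC u; rewrite dot_suml mulr_suml.
by apply: ler_sum => i _; exact: FC.
Qed.

End Norms.

(** * The proximal map and the regret of centralized dual averaging *)

Section ProximalMap.
Context {R : realType} {d : nat}.
Variables (N psi : 'rV[R]_d -> R) (X : set 'rV[R]_d).
Hypothesis N_norm : is_norm N.
Hypothesis psi_prox : proximal_function N X psi.
Hypothesis X_convex : convex_set X.

Lemma convex_set_segment x y l : X x -> X y -> 0 <= l -> l <= 1 ->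
  X (l *: x + (1 - l) *: y).
Proof.
move=> Xx Xy l0 l1; pose t : {i01 R} := Itv01 l0 l1.
by have := X_convex t (mem_set Xx) (mem_set Xy); rewrite inE.
Qed.

(* Obtained from the gradient inequality at the intermediate point, towards
   both ends. *)
Lemma strongly_convex_segment x y l : X x -> X y -> 0 <= l -> l <= 1 ->
  psi (l *: x + (1 - l) *: y) + 2^-1 * (l * (1 - l)) * N (x - y) ^+ 2 <=
  l * psi x + (1 - l) * psi y.
Proof.
move=> Xx Xy l0 l1; have [_ sc _ _] := psi_prox; have [_ NZ _] := N_norm.
set w := l *: x + (1 - l) *: y.
have Xw : X w by exact: convex_set_segment.
have Ex : x - w = (1 - l) *: (x - y).
  by apply/rowP => k; rewrite !mxE; ring.
have Ey : y - w = - l *: (x - y).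
  by apply/rowP => k; rewrite !mxE; ring.
have := sc w x Xw Xx; rewrite (is_norm_distC _ _ N_norm) Ex dotZr NZ ger0_norm ?subr_ge0//.
have := sc w y Xw Xy; rewrite (is_norm_distC _ _ N_norm) Ey dotZr NZ normrN ger0_norm//.
set G := dot _ _; set D := N (x - y) => Hy Hx.
have l1' : 0 <= 1 - l by rewrite subr_ge0.
have := ler_wpM2l l0 Hx; have := ler_wpM2l l1' Hy.
have -> : 2^-1 * (l * (1 - l)) * D ^+ 2 =
  2^-1 * (l * ((1 - l) * D) ^+ 2 + (1 - l) * (l * D) ^+ 2) by ring.
lra.
Qed.

(** Minimality against the point at fraction [l] of the way from [x] to [y], combined with strong
    convexity on the segment, gives the bound up to a factor [1 - l] on the quadratic term; then [l]
    tends to 0. *)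
Lemma prox_growth z a x y : 0 < a -> prox X psi z a x -> X y ->
  dot z x + a^-1 * psi x + (2 * a)^-1 * N (x - y) ^+ 2 <= dot z y + a^-1 * psi y.
Proof.
move=> a0 [Xx xmin] Xy.
have ia0 : 0 < a^-1 by rewrite invr_gt0.
set h := fun w => dot z w + a^-1 * psi w.
have D0 : 0 <= N (x - y) ^+ 2 by rewrite sqr_ge0.
have key l : 0 < l -> l <= 1 -> (2 * a)^-1 * (1 - l) * N (x - y) ^+ 2 <= h y - h x.
  move=> l0 l1.
  have l0' : 0 <= 1 - l by rewrite subr_ge0.
  have l1' : 1 - l <= 1 by rewrite lerBlDr lerDl ltW.
  have := xmin _ (convex_set_segment Xx Xy l0' l1').
  have := strongly_convex_segment Xx Xy l0' l1'.
  rewrite subKr dotDr !dotZr; move: (psi _) => q Hq Hmin.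
  rewrite -(ler_pM2l l0).
  have := ler_wpM2l (ltW ia0) Hq; rewrite /h invfM; move: Hmin; nra.
rewrite -/(h y) -/(h x) -lerBrDl.
apply/ler_addgt0Pr => e e0.
have C0 : 0 <= (2 * a)^-1 * N (x - y) ^+ 2.
  by rewrite mulr_ge0// invr_ge0 mulr_ge0// ltW.
set C := _ * _ in C0 *.
have C1 : 0 < C + 1 by rewrite ltr_wpDl.
(* Small enough for the loss [l * C] to stay below the slack [e]; the [+ 1] covers [C = 0]. *)
pose l := Num.min 1 (e / (C + 1)).
have l0 : 0 < l by rewrite lt_min ltr01 divr_gt0.
have := key l l0; rewrite ge_min lexx/= => /(_ isT).
have lC : l * C <= e.
  apply: (@le_trans _ _ (e / (C + 1) * C)); first by rewrite ler_wpM2r// ge_min lexx orbT.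
  by rewrite -mulrA ler_piMr ?(ltW e0)// mulrC ler_pdivrMr// mul1r lerDl.
have -> : (2 * a)^-1 * (1 - l) * N (x - y) ^+ 2 = C - l * C by rewrite /C; ring.
lra.
Qed.

(** The growth inequalities at the two minimizers add up to [a^-1 * D ^+ 2 <= C * D], where [D] is
    their distance. *)
Lemma prox_lipschitz z z' a x x' C : 0 < a -> 0 <= C ->
  prox X psi z a x -> prox X psi z' a x' -> dual_le N (z - z') C ->
  N (x - x') <= a * C.
Proof.
move=> a0 C0 px px' zC; have [[Xx _] [Xx' _]] := (px, px').
have := prox_growth a0 px Xx'; have := prox_growth a0 px' Xx.
rewrite (is_norm_distC _ _ N_norm) invfM; set D := N (x - x').
have D0 : 0 <= D by exact: is_norm_ge0.
have := zC (x' - x); rewrite dotDl !dotDr !dotNl !dotNr (is_norm_distC _ _ N_norm) -/D => H1 H2 H3.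
have H : a^-1 * D ^+ 2 <= C * D by lra.
have [->|D_neq0] := eqVneq D 0; first by rewrite mulr_ge0// ltW.
have Dgt0 : 0 < D by rewrite lt_neqAle eq_sym D_neq0.
by move: H; rewrite expr2 mulrA ler_pM2r// mulrC ler_pdivrMr// mulrC.
Qed.

(** The run supplies minimizers only for the local states; this one supplies them for the averaged
    state. The objective vanishes at 0, and strong convexity at 0 makes it grow quadratically
    against a linear term, so its sublevel set at 0 is compact. *)
Lemma prox_exists z a : closed X -> X 0 -> 0 < a -> exists x, prox X psi z a x.
Proof.
move=> cX X0 a0; have [dpsi sc _ psi0] := psi_prox.
pose h := fun w => dot z w + a^-1 * psi w.
have h0 : h 0 = 0 by rewrite /h dot0r psi0 mulr0 addr0.
have ch : continuous h.
  have cdot : continuous (dot z : 'rV[R]_d -> R).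
    have [C C0 zC] := dual_leP z N_norm; have [C' C'0 NC'] := norm_le_mx_norm N_norm.
    apply: (@lipschitz_bound_continuous R 'rV[R]_d _ _ (mulr_ge0 C0 C'0)) => u v.
    rewrite -dotNr -dotDr; apply: le_trans (zC _) _.
    by rewrite -mulrA ler_wpM2l.
  suff gen (V : normedModType R) (l p : V -> R) : continuous l ->
      (forall u, differentiable p u) -> continuous (fun u => l u + a^-1 * p u).
    exact: (gen 'rV[R]_d).
  move=> cl dp u; apply: cvgD; first exact: cl.
  by apply: cvgMl_tmp; exact: differentiable_continuous.
have [C C0 hC] := dual_leP (- (z + a^-1 *: grad psi 0)) N_norm.
have hN y : X y -> h y <= 0 -> N y <= 2 * a * C.
  move=> Xy hy; have := sc 0 y X0 Xy; rewrite psi0 add0r subr0 sub0r (is_normN _ N_norm).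
  have := hC y; rewrite dotNl dotDl dotZl => H1 H2.
  have H3 : dot z y + a^-1 * (dot (grad psi 0) y + 2^-1 * N y ^+ 2) <= 0.
    by apply: le_trans hy; rewrite /h lerD2l ler_pM2l// invr_gt0.
  have H : (2 * a)^-1 * N y ^+ 2 <= C * N y by rewrite invfM; lra.
  have [->|N_neq0] := eqVneq (N y) 0; first by rewrite !mulr_ge0// ltW.
  have Ngt0 : 0 < N y by rewrite lt_neqAle eq_sym N_neq0 is_norm_ge0.
  move: H; rewrite expr2 mulrA ler_pM2r// mulrC ler_pdivrMr ?mulr_gt0//.
  by rewrite mulrC.
have [C' C'0 NC'] := mx_norm_le_norm N_norm.
have cK : compact (X `&` h @^-1` [set r | r <= 0]).
  apply: bounded_closed_compact.
    exists (C' * (2 * a * C)); split; first exact: num_real.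
    move=> M MM y [Xy hy] /=; apply: le_trans (ltW MM).
    by apply: le_trans (NC' y) _; rewrite ler_wpM2l// hN.
  apply: closedI => //; apply: closed_comp => [y _|]; last exact: closed_le.
  exact: ch.
have K0 : X `&` h @^-1` [set r | r <= 0] !=set0 by exists 0; rewrite /= h0.
have [c] := EVT_min_rV K0 cK (continuous_subspaceT ch).
rewrite inE => -[Xc hc] cmin; exists c; split => // y Xy.
have [hy|hy] := leP (h y) 0; first by apply: cmin; rewrite inE.
exact: le_trans hc (ltW hy).
Qed.

(** The induction in [key] quantifies over every comparator, so that its hypothesis can be used at
    the next iterate [y k.+1]. Passing from there to [w] by [prox_growth] gains a quadratic term in
    their distance [D], which absorbs [L * D] at the price of [L ^+ 2 / 2 * alpha k]. *)
Lemma dual_averaging_regret (alpha : nat -> R) (g y : nat -> 'rV[R]_d) L T :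
  (forall t, 0 < alpha t) -> nonincreasing_seq alpha ->
  (forall t, (1 <= t)%N -> dual_le N (g t) L) ->
  (forall t, (1 <= t)%N ->
     prox X psi (\sum_(1 <= s < t) g s) (alpha t.-1) (y t)) ->
  forall w, X w ->
  \sum_(1 <= t < T.+1) dot (g t) (y t - w) <=
  (alpha T)^-1 * psi w + L ^+ 2 / 2 * \sum_(1 <= t < T.+1) alpha t.-1.
Proof.
move=> a0 an gL py; have [_ _ psi_ge0 _] := psi_prox.
have key k w : X w ->
    \sum_(1 <= t < k.+1) (dot (g t) (y t) - L ^+ 2 / 2 * alpha t.-1) <=
    dot (\sum_(1 <= s < k.+1) g s) w + (alpha k)^-1 * psi w.
  elim: k w => [|k IH] w Xw.
    by rewrite !big_nil// dot0l add0r mulr_ge0 ?psi_ge0// invr_ge0 ltW.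
  rewrite !(big_nat_recr k.+1)//= dotDl.
  have pyk := py k.+1 isT; have [Xy _] := pyk.
  have := prox_growth (a0 k) pyk Xw; have := IH _ Xy.
  rewrite invfM; set D := N (y k.+1 - w); set Z := \sum_(1 <= s < k.+1) g s.
  set S := \sum_(1 <= t < k.+1) _ => H1 H2.
  have := gL k.+1 isT (y k.+1 - w); rewrite dotDr dotNr -/D => H3.
  have amono : (alpha k)^-1 * psi w <= (alpha k.+1)^-1 * psi w.
    rewrite ler_wpM2r ?psi_ge0// lef_pV2 ?posrE//.
    exact: (an k k.+1 (leqnSn k)).
  have : L * D <= L ^+ 2 / 2 * alpha k + 2^-1 * (alpha k)^-1 * D ^+ 2.
    rewrite -subr_ge0.
    have -> : L ^+ 2 / 2 * alpha k + 2^-1 * (alpha k)^-1 * D ^+ 2 - L * D =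
      (2 * alpha k)^-1 * (L * alpha k - D) ^+ 2.
      by field; rewrite gt_eqF.
    by rewrite mulr_ge0 ?sqr_ge0// invr_ge0 mulr_ge0// ltW.
  lra.
move=> w Xw; have := key T w Xw.
rewrite sumrB -mulr_sumr dot_suml => H.
have -> : \sum_(1 <= t < T.+1) dot (g t) (y t - w) =
   \sum_(1 <= t < T.+1) dot (g t) (y t) - \sum_(1 <= t < T.+1) dot (g t) w.
  by rewrite -sumrB; apply: eq_bigr => t _; rewrite dotDr dotNr.
lra.
Qed.

End ProximalMap.

(** * The suboptimality of the local averages on one trajectory, given a bound on the
    disagreement *)

Lemma convex_function_average (R : realType) (d : nat) (h : 'rV[R]_d -> R)
    (x : nat -> 'rV[R]_d) T : convex_function setT h ->
  h (T.+1%:R^-1 *: \sum_(1 <= t < T.+2) x t) <=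
  T.+1%:R^-1 * \sum_(1 <= t < T.+2) h (x t).
Proof.
move=> ch; elim: T => [|T IH]; first by rewrite !big_nat1 invr1 scale1r mul1r.
pose l : R := T.+1%:R / T.+2%:R.
have T1 : T.+1%:R != 0 :> R by rewrite pnatr_eq0.
have T2 : T.+2%:R != 0 :> R by rewrite pnatr_eq0.
have l0 : 0 <= l by rewrite divr_ge0.
have l1 : l <= 1 by rewrite ler_pdivrMr ?ltr0n// mul1r ler_nat.
have El : 1 - l = T.+2%:R^-1.
  have E2 : T.+2%:R = T.+1%:R + 1 :> R by rewrite natr1.
  by rewrite /l; move: T2; rewrite E2 => T2; field.
have El2 : l * T.+1%:R^-1 = T.+2%:R^-1.
  by rewrite /l mulrAC divff ?mul1r.
have := ch (Itv01 l0 l1) (T.+1%:R^-1 *: \sum_(1 <= t < T.+2) x t) (x T.+2).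
rewrite !inE => /(_ I I).
set u := conv _ _ _; set v := conv _ _ _.
have -> : u = T.+2%:R^-1 *: \sum_(1 <= t < T.+3) x t.
  rewrite (big_nat_recr T.+2)//= scalerDr /u.
  transitivity (l *: (T.+1%:R^-1 *: \sum_(1 <= t < T.+2) x t) + (1 - l) *: x T.+2) => //.
  by rewrite El scalerA El2.
have -> : v = l * h (T.+1%:R^-1 *: \sum_(1 <= t < T.+2) x t) + (1 - l) * h (x T.+2) by [].
move=> H; apply: le_trans H _.
rewrite (big_nat_recr T.+2)//= mulrDr El lerD2r.
apply: le_trans (ler_wpM2l l0 IH) _.
by rewrite mulrA El2.
Qed.

Lemma sum_pred_shift (R : realType) (a : nat -> R) T : (forall t, 0 <= a t) ->
  \sum_(1 <= t < T.+1) (if t == 1%N then 0 else a t.-1) <= \sum_(1 <= t < T.+1) a t.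
Proof.
move=> a0; case: T => [|T]; first by rewrite !big_nil.
rewrite big_ltn// eqxx add0r big_add1 /=.
rewrite [leRHS]big_nat_recr//= -[leLHS]addr0 lerD//.
by apply: ler_sum_nat => t /andP[t1 _]; rewrite eqSS gtn_eqF.
Qed.

Section DeterministicBound.
Context {R : realType} {d n : nat}.
Variables (X : set 'rV[R]_d) (N : 'rV[R]_d -> R) (f : 'I_n -> 'rV[R]_d -> R) (L : R).
Variables (psi : 'rV[R]_d -> R) (alpha : nat -> R) (P : nat -> 'M[R]_n).
Variables (g z x : nat -> 'I_n -> 'rV[R]_d).
Hypothesis X_closed : closed X.
Hypothesis X_convex : convex_set X.
Hypothesis X_0 : X 0.
Hypothesis N_norm : is_norm N.
Hypothesis f_convex : forall i, convex_function setT (f i).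
Hypothesis f_lipschitz : forall i, lipschitz_wrt N X L (f i).
Hypothesis g_dual : forall t i, (1 <= t)%N -> dual_le N (g t i) L.
Hypothesis L_ge0 : 0 <= L.
Hypothesis psi_prox : proximal_function N X psi.
Hypothesis alpha_gt0 : forall t, 0 < alpha t.
Hypothesis alpha_nonincreasing : nonincreasing_seq alpha.
Hypothesis P_stochastic : forall t, doubly_stochastic (P t).
Hypothesis run : dual_averaging X psi f alpha P g z x.
Hypothesis n_gt0 : (0 < n)%N.

Definition node_average (v : 'I_n -> 'rV[R]_d) : 'rV[R]_d := n%:R^-1 *: \sum_j v j.

Let nn0 : n%:R != 0 :> R.
Proof. by rewrite pnatr_eq0 -lt0n. Qed.

Lemma node_average_dual_le v : (forall j, dual_le N (v j) L) -> dual_le N (node_average v) L.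
Proof.
move=> vL u; rewrite dotZl dot_suml.
have n0 : 0 < n%:R :> R by rewrite ltr0n.
rewrite mulrC ler_pdivrMr//.
apply: le_trans (ler_sum _ (fun j _ => vL j u)) _.
by rewrite sumr_const card_ord mulr_natr.
Qed.

(** Column sums equal to 1 make mixing preserve the average, so the averaged state evolves as in
    dual averaging without a network, driven by averaged subgradients. *)
Lemma node_average_state t : (1 <= t)%N ->
  node_average (z t) = \sum_(1 <= s < t) node_average (g s).
Proof.
have [init _ step _] := run.
elim: t => // -[_ _|t IH _].
  rewrite big_nil /node_average big1 ?scaler0// => i _.
  by have [] := init i.
rewrite (big_nat_recr t.+1)//= -IH// /node_average -scalerDr; congr (_ *: _).
under eq_bigr do rewrite step//.
rewrite big_split/= exchange_big/=; congr (_ + _).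
apply: eq_bigr => j _; rewrite -scaler_suml.
by have [_ _ ->] := P_stochastic t.+1; rewrite scale1r.
Qed.

Lemma iterate_prox t i : (1 <= t)%N -> prox X psi (z t i) (alpha t.-1) (x t i).
Proof.
have [init _ _ px] := run.
by case: t => // -[_|t _]; [have [-> ] := init i|exact: px].
Qed.

(* The weight of the disagreement at time t is alpha (t - 1), but there is no
   disagreement at time 1, which restores the sum of the alpha t. *)
Lemma network_regret (K : R) T i w : (1 <= T)%N -> X w -> 0 <= K ->
  (forall t j, (1 <= t <= T)%N -> dual_le N (z t j - node_average (z t)) (L * K)) ->
  objective f (local_average x T i) - objective f w <=
  (T%:R * alpha T)^-1 * psi w
  + L ^+ 2 / (2 * T%:R) * (\sum_(1 <= t < T.+1) alpha (t - 1)%N)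
  + 3 * L ^+ 2 / T%:R * K * (\sum_(1 <= t < T.+1) alpha t).
Proof.
move=> T1 Xw K0 disagree.
have /choice[y yP] : forall t, exists u, prox X psi (node_average (z t)) (alpha t.-1) u.
  by move=> t; exact: (prox_exists N_norm psi_prox).
have yX t : X (y t) by have [] := yP t.
have xX t j : (1 <= t)%N -> X (x t j) by move=> /(iterate_prox j)[].
pose delta t := if t == 1%N then 0 else alpha t.-1 * (L * K).
have xy t j : (1 <= t <= T)%N -> N (x t j - y t) <= delta t.
  move=> tT; have /andP[t1 _] := tT; rewrite /delta; case: eqP => [t11|_].
    subst t; rewrite -[leRHS](mulr0 (alpha 0)).
    apply: prox_lipschitz (iterate_prox j t1) (yP 1) _ => //.
    rewrite node_average_state// big_nil; have [init _ _ _] := run.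
    by have [-> _] := init j; rewrite subrr => u; rewrite dot0l mul0r.
  apply: prox_lipschitz (iterate_prox j t1) (yP t) _ => //.
    by rewrite mulr_ge0.
  exact: disagree.
have lip t j a b : X a -> X b -> N (a - b) <= delta t ->
    f j a - f j b <= L * delta t.
  move=> Xa Xb ab; apply: le_trans (ler_norm _) _.
  by apply: le_trans (f_lipschitz j Xa Xb) _; rewrite ler_wpM2l.
have step t : (1 <= t <= T)%N -> objective f (x t i) - objective f w <=
    dot (node_average (g t)) (y t - w) + 3 * L * delta t.
  move=> tT; have /andP[t1 _] := tT; have [_ sub _ _] := run.
  rewrite /objective -mulrBr -sumrB dotZl dot_suml.
  have -> : 3 * L * delta t = n%:R^-1 * \sum_(j < n) 3 * L * delta t.
    by rewrite sumr_const card_ord -(mulr_natl (3 * L * delta t)) mulKf.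
  rewrite -mulrDr -big_split/=; apply: ler_wpM2l; first by rewrite invr_ge0.
  apply: ler_sum => j _.
  (* The factor 3: [f j] is moved from [x t i] to [y t], then from [y t] to [x t j], where [g t j]
     is a subgradient, and finally the linear term is moved from [x t j] back to [y t]. Each move
     costs [L * delta t]. *)
  have h1 := lip t j _ _ (xX t i t1) (yX t) (xy t i tT).
  have h2 : f j (y t) - f j (x t j) <= L * delta t.
    by apply: lip => //; [exact: xX|rewrite is_norm_distC//; exact: xy].
  have h3 := sub t j t1 w.
  have h4 := g_dual j t1 (x t j - y t).
  have h5 : L * N (x t j - y t) <= L * delta t by rewrite ler_wpM2l// xy.
  move: h3 h4; rewrite !dotDr !dotNr; lra.
have gL t : (1 <= t)%N -> dual_le N (node_average (g t)) L.
  by move=> t1; apply: node_average_dual_le => j; exact: g_dual.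
have yP' t : (1 <= t)%N ->
    prox X psi (\sum_(1 <= s < t) node_average (g s)) (alpha t.-1) (y t).
  by move=> t1; rewrite -node_average_state.
have regret := dual_averaging_regret N_norm psi_prox X_convex T alpha_gt0
  alpha_nonincreasing gL yP' Xw.
have Tgt0 : 0 < T%:R :> R by rewrite ltr0n.
have jensen : T%:R * objective f (local_average x T i) <=
    \sum_(1 <= t < T.+1) objective f (x t i).
  rewrite /objective -mulr_sumr mulrCA ler_wpM2l ?invr_ge0// exchange_big/= mulr_sumr.
  apply: ler_sum => j _; rewrite mulrC -ler_pdivlMr// mulrC /local_average.
  by case: (T) T1 => // T' _; exact: convex_function_average.
have steps : \sum_(1 <= t < T.+1) objective f (x t i) - T%:R * objective f w <=
    \sum_(1 <= t < T.+1) dot (node_average (g t)) (y t - w) +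
    3 * L * \sum_(1 <= t < T.+1) delta t.
  rewrite mulr_sumr -big_split/= mulr_natl -[T in _ *+ T]subn0 -subSS.
  by rewrite -sumr_const_nat -sumrB; apply: ler_sum_nat => t tT; exact: step.
have sumd : \sum_(1 <= t < T.+1) delta t <= L * K * \sum_(1 <= t < T.+1) alpha t.
  rewrite mulrC mulr_suml.
  apply: (@sum_pred_shift _ (fun t => alpha t * (L * K))) => t.
  by rewrite mulr_ge0 ?mulr_ge0// ltW.
under [X in _ + _ * X + _]eq_bigr do rewrite subn1.
have L3 : 0 <= 3 * L by rewrite mulr_ge0.
have := ler_wpM2l L3 sumd; move: steps regret jensen.
set S1 := \sum_(1 <= t < T.+1) objective f (x t i).
set S2 := \sum_(1 <= t < T.+1) dot _ _.
set S3 := \sum_(1 <= t < T.+1) delta t.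
set S4 := \sum_(1 <= t < T.+1) alpha t.-1.
set S5 := \sum_(1 <= t < T.+1) alpha t.
set A := objective f (local_average x T i); set B := objective f w => h1 h2 h3 h4.
rewrite -(ler_pM2l Tgt0).
have aT : alpha T != 0 by rewrite gt_eqF.
have Tn : T%:R != 0 :> R by rewrite gt_eqF.
have -> : T%:R * ((T%:R * alpha T)^-1 * psi w + L ^+ 2 / (2 * T%:R) * S4 +
    3 * L ^+ 2 / T%:R * K * S5) =
  (alpha T)^-1 * psi w + L ^+ 2 / 2 * S4 + 3 * L * (L * K * S5).
  by field; rewrite aT Tn.
lra.
Qed.

End DeterministicBound.

(** * The disagreement of the dual states in terms of the matrix products *)

(** A subgradient from time [s] enters the state unmixed at time [s + 1] and then meets the
    [t - 1 - s] matrices [P (s + 1)], ..., [P (t - 1)]. *)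
Lemma dual_state_expansion (R : realType) (d n : nat) (X : set 'rV[R]_d)
    (psi : 'rV[R]_d -> R) (f : 'I_n -> 'rV[R]_d -> R) (alpha : nat -> R)
    (P : nat -> 'M[R]_n) (g z x : nat -> 'I_n -> 'rV[R]_d) t i :
  dual_averaging X psi f alpha P g z x -> (1 <= t)%N ->
  z t i = \sum_(1 <= s < t) \sum_j transition P s (t.-1 - s) i j *: g s j.
Proof.
move=> [init _ step _]; elim: t i => // -[_ i _|t IH i _].
  by rewrite big_nil; have [] := init i.
rewrite step// (big_nat_recr t.+1)//=; congr (_ + _); last first.
  rewrite subnn/= (bigD1 i)//= mxE eqxx scale1r big1 ?addr0// => j ji.
  by rewrite mxE eq_sym (negbTE ji) scale0r.
under eq_bigr => j _ do rewrite IH//= scaler_sumr.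
rewrite exchange_big/=; apply: eq_big_nat => s /andP[s1 st].
under eq_bigr do rewrite scaler_sumr.
rewrite exchange_big/=; apply: eq_bigr => j _.
rewrite subSn//= addnS subnKC// mxE scaler_suml.
by apply: eq_bigr => k _; rewrite scalerA.
Qed.

Lemma consensus_error_transition_nonincreasing (R : realType) n
    (P : nat -> 'M[R]_n) s k k' : (forall t, doubly_stochastic (P t)) ->
  (k <= k')%N ->
  consensus_error (transition P s k') <= consensus_error (transition P s k).
Proof.
move=> dP /subnKC <-; elim: (k' - k)%N => [|m IH]; first by rewrite addn0.
by rewrite addnS; apply: le_trans IH; exact: consensus_errorM.
Qed.

Lemma sum_two_regimes (R : realType) (a b : R) k0 m : 0 <= a -> 0 <= b ->
  \sum_(0 <= k < m) (if (k < k0)%N then a else b) <= a * k0%:R + b * m%:R.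
Proof.
move=> a0 b0; apply: (@le_trans _ _ (a * (minn m k0)%:R + b * m%:R)); last first.
  by rewrite lerD2r ler_wpM2l// ler_nat geq_minr.
elim: m => [|m IH]; first by rewrite big_nil min0n !mulr0 addr0.
rewrite big_nat_recr//=.
have Em : b * m.+1%:R = b * m%:R + b by rewrite -natr1 mulrDr mulr1.
case: ltnP => mk.
  move: IH; rewrite (minn_idPl mk) (minn_idPl (ltnW mk)) Em -natr1; lra.
move: IH; rewrite (minn_idPr mk) (minn_idPr (leqW mk)) Em; lra.
Qed.

Section Disagreement.
Context {R : realType} {d n : nat}.
Variables (X : set 'rV[R]_d) (N : 'rV[R]_d -> R) (f : 'I_n -> 'rV[R]_d -> R) (L : R).
Variables (psi : 'rV[R]_d -> R) (alpha : nat -> R) (P : nat -> 'M[R]_n).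
Variables (g z x : nat -> 'I_n -> 'rV[R]_d).
Hypothesis N_norm : is_norm N.
Hypothesis g_dual : forall t i, (1 <= t)%N -> dual_le N (g t i) L.
Hypothesis L_ge0 : 0 <= L.
Hypothesis P_stochastic : forall t, doubly_stochastic (P t).
Hypothesis run : dual_averaging X psi f alpha P g z x.
Hypothesis n_gt0 : (0 < n)%N.

Lemma disagreement_dual_le t i : (1 <= t)%N ->
  dual_le N (z t i - node_average (z t))
    (L * \sum_(1 <= s < t) \sum_j `|transition P s (t.-1 - s) i j - n%:R^-1|).
Proof.
move=> t1; rewrite (node_average_state P_stochastic run)// (dual_state_expansion i run)//.
rewrite -sumrB mulr_sumr => u.
rewrite dot_suml mulr_suml; apply: ler_sum_nat => s /andP[s1 _].
suff : dual_le N (\sum_j (transition P s (t.-1 - s) i j - n%:R^-1) *: g s j)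
    (\sum_j `|transition P s (t.-1 - s) i j - n%:R^-1| * L).
  rewrite -mulr_suml mulrC /node_average scaler_sumr -sumrB.
  by under [X in dual_le _ X _]eq_bigr do rewrite scalerBl; apply.
by apply: dual_le_sum => j; apply: dual_leZ => //; exact: g_dual.
Qed.

(** Each product length from 0 to [t - 2] occurs once, so at most [k0] products are short. A long
    one costs at most [c], the square root of n times the threshold, which is 1/(T^2 sqrt n); fewer
    than T of them cost at most 1/(T sqrt n). *)
Lemma disagreement_le T t i k0 : (1 <= t <= T)%N ->
  (forall s, (s < T)%N ->
     consensus_error (transition P s k0) <= (T%:R ^+ 4 * n%:R ^+ 2)^-1) ->
  dual_le N (z t i - node_average (z t))
    (L * (2 * k0%:R + (T%:R * Num.sqrt n%:R)^-1)).
Proof.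
move=> /andP[t1 tT] small; apply: dual_le_trans (disagreement_dual_le i t1) => //.
have T0 : 0 < T%:R :> R by rewrite ltr0n (leq_trans t1).
have n0 : 0 < n%:R :> R by rewrite ltr0n.
apply: ler_wpM2l => //.
pose c : R := (T%:R ^+ 2 * Num.sqrt n%:R)^-1.
have c0 : 0 <= c by rewrite invr_ge0 mulr_ge0 ?sqrtr_ge0// exprn_ge0// ltW.
have Ec : Num.sqrt (n%:R * (T%:R ^+ 4 * n%:R ^+ 2)^-1) = c.
  have -> : n%:R * (T%:R ^+ 4 * n%:R ^+ 2)^-1 = c ^+ 2.
    rewrite /c exprVn exprMn sqr_sqrtr ?(ltW n0)//.
    by field; rewrite !gt_eqF.
  by rewrite sqrtr_sqr ger0_norm.
apply: (@le_trans _ _ (\sum_(1 <= s < t) (if (t.-1 - s < k0)%N then 2 else c))).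
  apply: ler_sum_nat => s /andP[s1 st].
  have dM := doubly_stochastic_transition s (t.-1 - s) P_stochastic.
  case: ltnP => k; first exact: norm1_row_le2.
  apply: le_trans (norm1_row_le_error _ _ n_gt0) _; rewrite -Ec ler_wsqrtr//.
  rewrite ler_wpM2l ?(ltW n0)//; apply: le_trans (small s (leq_trans st tT)).
  exact: consensus_error_transition_nonincreasing.
have -> : \sum_(1 <= s < t) (if (t.-1 - s < k0)%N then 2 else c) =
    \sum_(0 <= k < t.-1) (if (k < k0)%N then 2 else c).
  case: t t1 {tT} => // t _; rewrite big_add1/= big_nat_rev/= add0n.
apply: eq_big_nat => s /andP[_ st]; congr (if (_ < _)%N then _ else _).
  by rewrite (subnSK st) (subKn (ltnW st)).
apply: le_trans (sum_two_regimes k0 t.-1 _ c0) _ => //.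
rewrite lerD2l; apply: (@le_trans _ _ (c * T%:R)).
  by rewrite ler_wpM2l// ler_nat (leq_trans (leq_pred _)).
rewrite le_eqVlt; apply/orP; left; apply/eqP; rewrite /c.
by field; rewrite !gt_eqF// sqrtr_gt0.
Qed.

End Disagreement.

(** * The choice of the product length and the final bound *)

(** From [rho <= expR (rho - 1)], the power is at most the exponential of [- k * (1 - rho)]. For
    [rho <= 0] the base is 0, and the exponent must be positive. *)
Lemma max0_expr_le (R : realType) (rho y : R) k : rho < 1 -> 1 <= y ->
  3 * ln y / (1 - rho) <= k%:R -> (0 < k)%N ->
  Num.max 0 rho ^+ k <= (y ^+ 3)^-1.
Proof.
move=> rho1 y1 yk k0; have y0 : 0 < y by exact: lt_le_trans y1.
have [r0|r0] := leP rho 0.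
  by rewrite expr0n gtn_eqF// invr_ge0 exprn_ge0// ltW.
apply: (@le_trans _ _ (expR (rho - 1) ^+ k)).
  rewrite lerXn2r ?nnegrE ?expR_ge0 ?(ltW r0)//.
  by have := expR_ge1Dx (rho - 1); rewrite addrC subrK.
rewrite -expRM_natl -[leRHS]lnK ?posrE ?invr_gt0 ?exprn_gt0// ler_expR.
rewrite lnV ?posrE ?exprn_gt0// lnXn// -mulr_natl.
move: yk; rewrite ler_pdivrMr ?subr_gt0//; lra.
Qed.

Theorem theorem3 (R : realType) (d n : nat)
  (disp : measure_display) (Omega : measurableType disp)
  (Pr : probability Omega R)
  (e : rel 'I_n) (e_sym : symmetric e)
  (X : set 'rV[R]_d)
  (X_closed : closed X) (X_convex : convex_set X) (X_0 : X 0)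
  (N : 'rV[R]_d -> R) (N_norm : is_norm N)
  (f : 'I_n -> 'rV[R]_d -> R)
  (f_convex : forall i, convex_function setT (f i))
  (L : R)
  (f_lipschitz : forall i, lipschitz_wrt N X L (f i))
  (f_subgradient : forall i x v,
     X x -> subdifferential (f i) x v -> dual_norm N v <= L)
  (psi : 'rV[R]_d -> R) (psi_prox : proximal_function N X psi)
  (alpha : nat -> R)
  (alpha_gt0 : forall t, 0 < alpha t)
  (alpha_nonincreasing : nonincreasing_seq alpha)
  (P : nat -> Omega -> 'M[R]_n)
  (P_stochastic : forall t w, doubly_stochastic (P t w))
  (P_graph : forall t w, respects_graph e (P t w))
  (P_iid : iid_mx Pr P)
  (lambda2G_lt1 : lambda2G Pr P < 1)
  (g z x : Omega -> nat -> 'I_n -> 'rV[R]_d)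
  (run : forall w,
     dual_averaging X psi f alpha (fun t => P t w) (g w) (z w) (x w))
  (T : nat) (T_ge1 : (1 <= T)%N)
  (xstar : 'rV[R]_d) (X_xstar : X xstar) (i : 'I_n) :
  with_probability_ge Pr (1 - T%:R^-1)
    [set w | objective f (local_average (x w) T i) - objective f xstar <=
       (T%:R * alpha T)^-1 * psi xstar
       + L ^+ 2 / (2 * T%:R) * (\sum_(1 <= t < T.+1) alpha (t - 1)%N)
       + 3 * L ^+ 2 / T%:R
         * (6 * ln (T%:R ^+ 2 * n%:R) / (1 - lambda2G Pr P)
            + (T%:R * Num.sqrt n%:R)^-1 + 2)
         * (\sum_(1 <= t < T.+1) alpha t)].
Proof.
have n0 : (0 < n)%N by case: (n) i => // -[].
have nR : 0 < n%:R :> R by rewrite ltr0n.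
have TR : 0 < T%:R :> R by rewrite ltr0n.
set rho := lambda2G Pr P in lambda2G_lt1 *.
have rho1 : 0 < 1 - rho by rewrite subr_gt0.
pose y : R := T%:R ^+ 2 * n%:R.
have y1 : 1 <= y.
  by rewrite /y -natrX -natrM ler1n muln_gt0 expn_gt0 T_ge1 n0.
have lny : 0 <= ln y by rewrite ln_ge0.
(* The successor makes [k0] positive and at least the required length; it exceeds that length by at
   most 1, which is the source of the [+ 2] in the bound. *)
pose k0 := (Num.truncn (3 * ln y / (1 - rho))).+1.
have q0 : 0 <= 3 * ln y / (1 - rho) by rewrite divr_ge0 ?mulr_ge0// ltW.
have /andP[k0_le k0_gt] := truncn_itv q0.
pose eps : R := (T%:R ^+ 4 * n%:R ^+ 2)^-1.
have eps0 : 0 < eps by rewrite invr_gt0 mulr_gt0 ?exprn_gt0.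
have [A [mA AE pA]] :=
  mixing_errors_small_probability P_iid P_stochastic n0 T k0 lambda2G_lt1 eps0.
exists A; split => //.
  move=> w /AE /= small.
  have [init sub step px] := run w.
  have xX t j : (1 <= t)%N -> X (x w t j) by move=> /(iterate_prox (run w) j)[].
  have gL t j : (1 <= t)%N -> dual_le N (g w t j) L.
    move=> t1; apply: dual_le_trans (dual_le_dual_norm _ N_norm) => //.
    by apply: f_subgradient; [exact: xX t1|exact: sub].
  (* [L] dominates the dual norm of an actual subgradient, the one that node [i] picks at time 1. *)
  have L0 : 0 <= L.
    apply: le_trans (dual_norm_ge0 (g w 1 i) N_norm) _.
    by apply: f_subgradient; [exact: (xX 1%N i)|exact: sub].
  pose K := 6 * ln y / (1 - rho) + (T%:R * Num.sqrt n%:R)^-1 + 2.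
  have c0 : 0 <= (T%:R * Num.sqrt n%:R)^-1 :> R.
    by rewrite invr_ge0 mulr_ge0 ?sqrtr_ge0// ltW.
  have KE : 2 * k0%:R + (T%:R * Num.sqrt n%:R)^-1 <= K.
    rewrite /K; have -> : 6 * ln y / (1 - rho) = 2 * (3 * ln y / (1 - rho)) by ring.
    by rewrite /k0 -natr1; lra.
  have K0 : 0 <= K by apply: le_trans KE; rewrite addr_ge0// mulr_ge0.
  apply: (network_regret X_closed X_convex X_0 N_norm f_convex f_lipschitz gL L0
    psi_prox alpha_gt0 alpha_nonincreasing (P_stochastic^~ w) (run w) n0 i
    T_ge1 X_xstar K0) => t j tT.
  apply: (@dual_le_trans _ _ _ _ (L * (2 * k0%:R + (T%:R * Num.sqrt n%:R)^-1))) => //.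
    exact: ler_wpM2l.
  exact: (disagreement_le N_norm gL L0 (P_stochastic^~ w) (run w) n0 j tT).
(* It remains to bound the failure probability; with [y] = T^2 n, the powers of n cancel and exactly
   1/T is left. *)
apply: le_trans pA; rewrite lee_fin lerD2l lerN2.
have := max0_expr_le lambda2G_lt1 y1 (ltW k0_gt) isT.
rewrite -/k0 -/rho; set r := _ ^+ k0 => rk.
rewrite ler_pdivrMr//.
apply: (@le_trans _ _ (T%:R * ((y ^+ 3)^-1 * n%:R))).
  by rewrite ler_wpM2l ?(ltW TR)// ler_wpM2r// ltW.
rewrite le_eqVlt; apply/orP; left; apply/eqP; rewrite /y /eps.
by field; rewrite !gt_eqF.
Qed.
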